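(* Let $Q$ be an LDP-polygon. Then the associated toric log del Pezzo surface $X_Q$ has exactly two singular points if and only if one of the following conditions is satisfied: (1) There exist $p, q \in \mathbb{Z}$ such that $p, q \geq 2$, $\gcd(p, q)=1$ and $Q$ is equivalent to $$\mathrm{conv}\left\{\begin{pmatrix} 1 \\ 0 \end{pmatrix}, \begin{pmatrix} 0 \\ 1 \end{pmatrix}, \begin{pmatrix} -p \\ -q \end{pmatrix}\right\}.$$ (2) There exist $p, q, r \in \mathbb{Z}$ such that $p \leq 1$, $r \leq \min\{-pq-2, -2, -q-1, q-pq-1\}$, $\gcd(q, r)=1$ and $Q$ is equivalent to $$\mathrm{conv}\left\{\begin{pmatrix} 1 \\ 0 \end{pmatrix}, \begin{pmatrix} 0 \\ 1 \end{pmatrix}, \begin{pmatrix} -1 \\ p \end{pmatrix}, \begin{pmatrix} q \\ r \end{pmatrix}\right\}.$$ (3) There exist $p, q, r \in \mathbb{Z}$ such that $p \leq 0$, $1 \leq q \leq -r-1$, $\gcd(q, r)=1$ and $Q$ is equivalent to $$\mathrm{conv}\left\{\begin{pmatrix} 1 \\ 0 \end{pmatrix}, \begin{pmatrix} 0 \\ 1 \end{pmatrix}, \begin{pmatrix} -1 \\ p+1 \end{pmatrix}, \begin{pmatrix} -1 \\ p \end{pmatrix}, \begin{pmatrix} q \\ r \end{pmatrix}\right\}.$$ In particular, if $X_Q$ has exactly two singular points, then the Picard number of $X_Q$ is at most three.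
   Context: A convex lattice polygon $Q \subset \mathbb{R}^2$ (vertices in $\mathbb{Z}^2$) is called an LDP-polygon if it contains the origin in its interior and every vertex is a primitive lattice vector. Two LDP-polygons $Q, Q'$ are equivalent if there is a $2\times 2$ unimodular matrix (integer matrix of determinant $\pm 1$) that transforms $Q$ into $Q'$. For an edge $F$ of $Q$ put $\sigma_F=\{\lambda x \mid \lambda \geq 0, x \in F\}\subset\mathbb{R}^2$. The cones $\sigma_F$ and their faces form a complete fan $\Delta_Q$ in $\mathbb{R}^2$, and $X_Q$ denotes the associated complete toric surface over $\mathbb{C}$. A normal projective surface is log del Pezzo if it has at worst log-terminal singularities (that is, quotient singularities) and its anticanonical divisor is a $\mathbb{Q}$-Cartier ample divisor; $X_Q$ is always a toric log del Pezzo surface. If $v_1,\dots,v_d$ are the vertices of $Q$ in counterclockwise order (with $v_{d+1}=v_1$), the singular points of $X_Q$ are the torus-fixed points corresponding to the two-dimensional cones $\mathbb{R}_{\geq 0}v_i+\mathbb{R}_{\geq 0}v_{i+1}$ with $\det(v_i,v_{i+1})\geq 2$, and the Picard number of $X_Q$ is $d-2$. *)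

(* Defs.v *)
From HB Require Import structures.
From mathcomp Require Import all_boot all_order all_algebra finmap.
From mathcomp Require Import all_classical all_reals all_analysis.
Import Order.TTheory GRing.Theory Num.Theory.
Import numFieldNormedType.Exports.

Set Implicit Arguments.
Unset Strict Implicit.
Unset Printing Implicit Defensive.

Local Open Scope classical_set_scope.
Local Open Scope ring_scope.

Definition latvec (a b : int) : 'cV[int]_2 := \col_i [:: a; b]`_i.

Definition primitive (v : 'cV[int]_2) : Prop := gcdz (v 0 0) (v 1 0) = 1.

Section Polygons.
Variable R : realType.
Local Notation plane := 'cV[R]_2.
Implicit Types (Q F s t A : set plane) (x y : plane).

Definition real_vec (v : 'cV[int]_2) : plane := map_mx intr v.

Definition convex_hull A : set plane := smallest (@convex_set R plane) A.

Definition pt (a b : int) : plane := real_vec (latvec a b).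

Definition dot (l : 'rV[R]_2) x : R := (l *m x) 0 0.

(* Excluding l = 0 excludes Q itself, so that for a two-dimensional polygon
   the nonempty proper faces are exactly its vertices and its edges. *)
Definition proper_face Q F : Prop :=
  exists l c, [/\ l != 0, forall x, Q x -> dot l x <= c
                & F = Q `&` [set x | dot l x = c]].

Definition vertices Q : set plane := [set x | proper_face Q [set x]].

(* In the plane a proper face lies on a line, so it is one-dimensional as soon
   as it has two distinct points. *)
Definition edges Q : set (set plane) :=
  [set F | proper_face Q F /\ exists x y, [/\ F x, F y & x <> y]].

(* Two-dimensionality is not required here: it follows from the origin being
   an interior point in LDP_polygon. *)
Definition lattice_polygon Q : Prop :=
  (exists2 A, finite_set A & Q = convex_hull A) /\
  (forall x, vertices Q x -> exists v, x = real_vec v).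

Definition LDP_polygon Q : Prop :=
  [/\ lattice_polygon Q, Q° 0
    & forall v, vertices Q (real_vec v) -> primitive v].

Definition equivalent Q Q' : Prop :=
  exists U : 'M[int]_2, (\det U = 1 \/ \det U = -1) /\
    [set map_mx intr U *m x | x in Q] = Q'.

Definition cone_over F : set plane :=
  [set z | exists k x, [/\ 0 <= k, F x & z = k *: x]].

(* l = 0 is allowed, so s is a face of itself. *)
Definition cone_face s t : Prop :=
  exists l, (forall x, s x -> dot l x <= 0) /\
    t = s `&` [set x | dot l x = 0].

(* The fan Delta_Q: the cones sigma_F over the edges F of Q, and their faces. *)
Definition fan Q : set (set plane) :=
  [set t | exists2 F, edges Q F & cone_face (cone_over F) t].

Definition pos_span x y : set plane :=
  [set z | exists a b, [/\ 0 <= a, 0 <= b & z = a *: x + b *: y]].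

(* The toric surface X_Q is given by its fan, and its singular points are
   torus-fixed, so a singular point is represented by the two-dimensional cone
   of the fan to which it corresponds: the cone of two consecutive vertices
   v, w with det (v, w) >= 2.  Consecutiveness is what membership of
   pos_span v w in the fan says, and the sign of the determinant makes the
   order counterclockwise. *)
Definition singular_points Q : set (set plane) :=
  [set s | fan Q s /\ exists v w : 'cV[int]_2,
     [/\ vertices Q (real_vec v), vertices Q (real_vec w),
         2 <= \det (row_mx v w)
       & s = pos_span (real_vec v) (real_vec w)]].

(* rho (X_Q) = d - 2 where d is the number of vertices; the default value of
   fset_set on infinite sets is irrelevant by finite_vertices below. *)
Definition picard_number Q : int := #|` fset_set (vertices Q)|%:Z - 2.

Lemma finite_vertices Q : LDP_polygon Q -> finite_set (vertices Q).
Proof.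
move=> [[[A finA QA] _] _ _]; apply: sub_finite_set finA => v.
move=> [l [c [_ Qle fv]]]; apply: contrapT => nAv.
have [Qv lv] : (Q `&` [set x | dot l x = c]) v by rewrite -fv.
have subA : A `<=` [set x | dot l x < c].
  move=> x Ax /=; have Qx : Q x by rewrite QA; exact: sub_gen_smallest.
  rewrite lt_neqAle Qle// andbT; apply/eqP => lx.
  have : (Q `&` [set x | dot l x = c]) x by [].
  by rewrite -fv => xv; apply: nAv; rewrite -xv.
have cvx : @convex_set R plane [set x | dot l x < c].
  apply/convex_setW => x y; rewrite !inE /= => lx ly k k0 k1; rewrite inE /=.
  have -> : dot l (k%:num *: (x : plane) + (1 - k%:num) *: (y : plane)) =
     k%:num * dot l x + (1 - k%:num) * dot l y.
    by rewrite /dot mulmxDr -!scalemxAr !mxE.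
  have -> : c = k%:num * c + (1 - k%:num) * c by rewrite -mulrDl subrKC mul1r.
  by apply: ltrD; rewrite ltr_pM2l// subr_gt0.
move: Qv; rewrite QA => /(_ _ (conj cvx subA)) /=.
by rewrite lv ltxx.
Qed.

End Polygons.

(* Main.v *)
(* In coordinates where a smooth cone is spanned by (1,0) and (0,1), strict convexity
   forces every other vertex into x + y <= 0, and three consecutive vertices spanning
   two smooth cones satisfy v_(i-1) + v_(i+1) = a_i v_i with a_i <= 1.  These
   inequalities show that at most three smooth cones are consecutive, and that the two
   arcs between the singular cones cannot both contain smooth cones.  So the two
   singular cones are adjacent and the others form a run of one, two or three smooth
   cones, which gives the types (1), (2) and (3).

   Passing from Q to its vertices: a linear functional, perturbed lexicographically,
   attains its maximum over Q at a vertex, so angularly consecutive vertices span the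
   edges, and Q is the convex hull of its vertices. *)

Require Import Defs.
From HB Require Import structures.
From mathcomp Require Import all_boot all_order all_algebra finmap.
From mathcomp Require Import all_classical all_reals all_analysis.
From mathcomp Require Import zify ring lra.
Import Order.TTheory GRing.Theory Num.Theory.
Import numFieldNormedType.Exports.

Set Implicit Arguments.
Unset Strict Implicit.
Unset Printing Implicit Defensive.

Local Open Scope classical_set_scope.
Local Open Scope ring_scope.

(** * Edges of polygons with integer vertices *)

(** The integer part works with a set [V] of integer pairs and its relation [edge] instead of a
    cyclic list of vertices, and every angular statement is a sign of [det2]. The price is that a
    walk along edges must be shown to exhaust [V]. This holds because the cone of an edge contains
    no vertex besides its two ends, so a chain of edges returning to its start cannot have skipped
    one. The convexity inequalities alone leave boundary cases, such as a vertex on x + y = 0 in the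
    standard coordinates of a smooth cone. Primitivity of the vertices removes them; this is also
    why some bounds in (2) and (3) are sharper by one than convexity gives. A run of three smooth
    cones has two mirror forms. Maps of determinant -1, which reverse every edge, reduce the second
    form to the first. *)

Definition vec : Type := (int * int)%type.

Definition det2 (u v : vec) : int := u.1 * v.2 - u.2 * v.1.

(* The last condition says that z lies strictly on the origin's side of the line
   through u and v. *)
Definition edge (V : vec -> Prop) (u v : vec) : Prop :=
  [/\ V u, V v, 0 < det2 u v &
      forall z, V z -> z != u -> z != v -> det2 u z + det2 z v < det2 u v].

Definition smooth_edge V u v := edge V u v /\ det2 u v = 1.

Definition singular_edge V u v := edge V u v /\ 2 <= det2 u v.

(** Primitivity with explicit witnesses, which can be transported by unimodular maps and substituted
    into equations. *)
Definition bezout (v : vec) : Prop := exists s t : int, s * v.1 + t * v.2 = 1.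

(** The combinatorial data retained from an LDP-polygon with vertex set [V]. That a closed chain of
    edges runs through all of [V] is derived from it in [chain_closed]. *)
Definition polygon (V : vec -> Prop) : Prop := forall v, V v ->
  [/\ bezout v, exists w, edge V v w & exists u, edge V u v].

Definition two_singular (V : vec -> Prop) : Prop :=
  exists u1 v1 u2 v2, [/\ singular_edge V u1 v1, singular_edge V u2 v2,
    (u1, v1) != (u2, v2) &
    forall u v, singular_edge V u v -> (u, v) = (u1, v1) \/ (u, v) = (u2, v2)].

Lemma gcdz_bezout (v : vec) : gcdz v.1 v.2 = 1 <-> bezout v.
Proof.
split=> [g1|[s [t st]]].
  by have [s [t st]] := Bezoutz v.1 v.2; exists s, t; rewrite st g1.
apply/eqP; rewrite -[_ == 1]/(coprimez v.1 v.2).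
by apply/coprimezP; exists (s, t).
Qed.

Lemma neq_det (u v : vec) : det2 u v != 0 -> u != v.
Proof. by apply: contraNneq => ->; apply/eqP; rewrite /det2; ring. Qed.

Lemma edge_le V u v z : edge V u v -> V z -> det2 u z + det2 z v <= det2 u v.
Proof.
case=> _ _ uv0 uvz Vz; have [->|zu] := eqVneq z u; first by rewrite /det2; lia.
have [->|zv] := eqVneq z v; first by rewrite /det2; lia.
exact/ltW/uvz.
Qed.

Lemma edge_neq V u v : edge V u v -> u != v.
Proof. by case=> _ _ uv0 _; apply: neq_det; rewrite gt_eqF. Qed.

(** If [v] and [w] differed, the strict inequalities of the two edges, each taken at the end of the
    other, would add up to 0 < 0. *)
Lemma edge_succ_inj V u v w : edge V u v -> edge V u w -> v = w.
Proof.
move=> uv uw; apply/eqP/negPn/negP => vw.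
have [_ Vv v0 uvP] := uv; have [_ Vw w0 uwP] := uw.
have := uvP w Vw; rewrite eq_sym (edge_neq uw) eq_sym vw.
have := uwP v Vv; rewrite eq_sym (edge_neq uv) vw.
by move=> /(_ isT isT) + /(_ isT isT); rewrite /det2; lia.
Qed.

Lemma edge_pred_inj V u v w : edge V v u -> edge V w u -> v = w.
Proof.
move=> uv uw; apply/eqP/negPn/negP => vw.
have [Vv _ v0 uvP] := uv; have [Vw _ w0 uwP] := uw.
have := uvP w Vw; rewrite (edge_neq uw) eq_sym vw.
have := uwP v Vv; rewrite (edge_neq uv) vw.
by move=> /(_ isT isT) + /(_ isT isT); rewrite /det2; lia.
Qed.

Lemma bezout_neq0 v : bezout v -> v != (0, 0).
Proof. by case=> s [t]; apply: contra_eqN => /eqP -> /=; lia. Qed.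

Lemma det2_plucker (u v w z : vec) :
  det2 u v * det2 w z = det2 u z * det2 w v + det2 v z * det2 u w.
Proof. by rewrite /det2; ring. Qed.

(** Another vertex [z] in the cone would be a combination of [u] and [v] with nonnegative
    coefficients of sum less than 1. The linear form of an edge leaving [z] is at [u] and [v] at
    most its positive value at [z], so at [z] it would be less than itself. *)
Lemma edge_cone V u v z : polygon V -> edge V u v -> V z ->
  0 <= det2 u z -> 0 <= det2 z v -> z = u \/ z = v.
Proof.
move=> PV uv Vz uz zv.
have [->|zu] := eqVneq z u; first by left.
have [->|zNv] := eqVneq z v; first by right.
exfalso.
have [Vu Vv uv0 /(_ z Vz zu zNv) lt1] := uv.
have [_ [w zw] _] := PV z Vz.
have := edge_le zw Vu; have := edge_le zw Vv.
have [_ _ zw0 _] := zw.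
have E : det2 u v * det2 z w =
   det2 u z * (det2 z v + det2 v w) + det2 z v * (det2 z u + det2 u w).
  by rewrite /det2; ring.
move: E uz zv uv0 zw0 lt1.
set a := det2 u v; set b := det2 z w; set c := det2 u z; set d := det2 z v.
set e := d + det2 v w; set f := det2 z u + det2 u w => E c0 d0 a0 b0 lt1 le1 le2.
have : c * e <= c * b by rewrite ler_wpM2l//; lia.
have : d * f <= d * b by rewrite ler_wpM2l//; lia.
have : (c + d) * b < a * b by rewrite ltr_pM2r.
move: E; rewrite mulrDl => -> h1 h2 h3.
by lia.
Qed.

(** * Chains of edges around the origin *)

Fixpoint chain (V : vec -> Prop) (u : vec) (s : seq vec) (w : vec) : Prop :=
  if s is v :: s' then edge V u v /\ chain V v s' w else edge V u w.

(** By [edge_cone] no edge steps over a vertex off the chain. So a vertex [z] at most half a turn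
    ahead of [u] stays ahead along the whole chain, and the chain turns by less than the angle from
    [u] to [z]. *)
Lemma chain_pos V u s w z : polygon V -> chain V u s w -> V z ->
  z \notin u :: s -> z != w -> 0 <= det2 u z -> 0 < det2 w z /\
  (0 < det2 u z -> 0 < det2 u w).
Proof.
move=> PV; elim: s u => [|v s IH] u /=.
  move=> uw Vz; rewrite mem_seq1 => zu zw uz; split; last by case: uw.
  rewrite ltNge; apply/negP => wz.
  have [|E|E] := edge_cone PV uw Vz uz; first by move: wz; rewrite /det2; lia.
    by rewrite E eqxx in zu.
  by rewrite E eqxx in zw.
move=> [uv vw] Vz; rewrite in_cons negb_or => /andP[zu zs] zw uz.
have zv : z != v by apply: contraNneq zs => ->; rewrite mem_head.
have vz : 0 < det2 v z.
  rewrite ltNge; apply/negP => wz.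
  have [|E|E] := edge_cone PV uv Vz uz; first by move: wz; rewrite /det2; lia.
    by rewrite E eqxx in zu.
  by rewrite E eqxx in zv.
have [wz /(_ vz) vw0] := IH v vw Vz zs zw (ltW vz); split=> // uz0.
have [_ _ uv0 _] := uv.
by have := det2_plucker u w v z; nia.
Qed.

(** The complementary case, with [z] more than half a turn ahead of [u]: either the chain has come
    within half a turn of [z], or it has itself turned by less than half a turn. *)
Lemma chain_neg V u s w z : polygon V -> chain V u s w -> V z ->
  z \notin u :: s -> z != w -> det2 u z < 0 ->
  0 <= det2 w z \/ (det2 w z < 0 /\ 0 < det2 u w).
Proof.
move=> PV; elim: s u => [|v s IH] u /=.
  move=> [_ _ uw0 _] Vz _ _ uz; have [] := leP 0 (det2 w z); first by left.
  by right.
move=> [uv vw] Vz; rewrite in_cons negb_or => /andP[zu zs] zw uz.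
have [vz|vz] := leP 0 (det2 v z).
  by left; apply/ltW; have [] := chain_pos PV vw Vz zs zw vz.
have [|[wz vw0]] := IH v vw Vz zs zw vz; first by left.
right; split=> //.
have [_ _ uv0 _] := uv.
by have := det2_plucker u w v z; nia.
Qed.

(** Returning to [u] without meeting [z] contradicts [chain_pos] or [chain_neg], because
    [det2 u u = 0]. A closed chain is thus an enumeration of [V]. *)
Lemma chain_closed V u s z : polygon V -> chain V u s u -> V z -> z \in u :: s.
Proof.
move=> PV us Vz; apply/negPn/negP => zs.
have zu : z != u by apply: contraNneq zs => ->; rewrite mem_head.
have uu : det2 u u = 0 by rewrite /det2; ring.
have [uz|uz] := leP 0 (det2 u z).
  by have := chain_pos PV us Vz zs zu uz; lia.
by have := chain_neg PV us Vz zs zu uz; lia.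
Qed.

(** * Unimodular changes of coordinates *)

Definition act (a b c d : int) (v : vec) : vec :=
  (a * v.1 + b * v.2, c * v.1 + d * v.2).

Definition equiv_act (a b c d : int) (V W : vec -> Prop) : Prop :=
  forall z, V z <-> W (act a b c d z).

Definition equivZ (V W : vec -> Prop) : Prop := exists a b c d,
  (a * d - b * c = 1 \/ a * d - b * c = -1) /\ equiv_act a b c d V W.

Lemma vec_eq (u v : vec) : u.1 = v.1 -> u.2 = v.2 -> u = v.
Proof. by case: u v => [? ?] [? ?] /= -> ->. Qed.

(** The inverse is [e] times the adjugate; with [e * e = 1] both determinants are covered at
    once. *)
Lemma act_inv a b c d e z : a * d - b * c = e -> e * e = 1 ->
  act a b c d (act (e * d) (- (e * b)) (- (e * c)) (e * a) z) = z.
Proof.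
move=> <- E; apply: vec_eq; rewrite /act /= -[RHS]mul1r -E; ring.
Qed.

Lemma act_invr a b c d e z : a * d - b * c = e -> e * e = 1 ->
  act (e * d) (- (e * b)) (- (e * c)) (e * a) (act a b c d z) = z.
Proof.
move=> <- E; apply: vec_eq; rewrite /act /= -[RHS]mul1r -E; ring.
Qed.

Lemma det2_act a b c d u v :
  det2 (act a b c d u) (act a b c d v) = (a * d - b * c) * det2 u v.
Proof. by rewrite /det2 /act /=; ring. Qed.

Lemma equiv_act_inv a b c d e V W : a * d - b * c = e -> e * e = 1 ->
  equiv_act a b c d V W ->
  equiv_act (e * d) (- (e * b)) (- (e * c)) (e * a) W V.
Proof. by move=> E ee VW z; rewrite VW (act_inv _ E ee). Qed.

Lemma edge_act a b c d V W u v : a * d - b * c = 1 -> equiv_act a b c d V W ->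
  edge V u v -> edge W (act a b c d u) (act a b c d v).
Proof.
move=> e VW [Vu Vv uv0 uvP]; split; [exact/VW | exact/VW | by rewrite det2_act e mul1r|].
have E z := act_inv z e (mulr1 1).
move=> z; rewrite -(E z); set y := act _ _ _ _ z => /VW Vy yu yv.
rewrite !det2_act e !mul1r; apply: uvP => //; first by apply: contraNneq yu => ->.
by apply: contraNneq yv => ->.
Qed.

Lemma edge_actN a b c d V W u v : a * d - b * c = -1 -> equiv_act a b c d V W ->
  edge V u v -> edge W (act a b c d v) (act a b c d u).
Proof.
have N1 : (-1) * (-1) = 1 :> int by [].
move=> e VW [Vu Vv uv0 uvP]; split; [exact/VW | exact/VW | |].
  by rewrite det2_act e; move: uv0; rewrite /det2; lia.
have E z := act_inv z e N1.
move=> z; rewrite -(E z); set y := act _ _ _ _ z => /VW Vy yv yu.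
rewrite !det2_act e; have yu' : y != u by apply: contraNneq yu => ->.
have yv' : y != v by apply: contraNneq yv => ->.
by have := uvP y Vy yu' yv'; rewrite /det2; lia.
Qed.

Lemma bezout_act a b c d z : a * d - b * c = 1 \/ a * d - b * c = -1 ->
  bezout z -> bezout (act a b c d z).
Proof.
move=> e [s [t st]]; rewrite /bezout /act /=.
have E : (a * d - b * c) * (s * z.1 + t * z.2) = a * d - b * c by rewrite st mulr1.
case: e => e.
  by exists (s * d - t * c), (t * a - s * b); rewrite -[RHS]e -E; ring.
exists (t * c - s * d), (s * b - t * a).
by rewrite -[RHS](opprK 1) -[in RHS]e -E; ring.
Qed.

Lemma polygon_act a b c d V W : a * d - b * c = 1 \/ a * d - b * c = -1 ->
  equiv_act a b c d V W -> polygon V -> polygon W.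
Proof.
move=> e VW PV z Wz.
have [y Vy ->] : exists2 y, V y & z = act a b c d y.
  have [f ff E] : exists2 f, f * f = 1 & a * d - b * c = f.
    by case: e => ->; [exists 1 | exists (-1)].
  eexists; last by rewrite -[LHS](act_inv z E ff).
  by apply/VW; rewrite (act_inv z E ff).
have [bz [w yw] [u uy]] := PV y Vy.
split; first exact: bezout_act.
  by case: e => e; [exists (act a b c d w); apply: edge_act e VW yw
                  | exists (act a b c d u); apply: edge_actN e VW uy].
by case: e => e; [exists (act a b c d u); apply: edge_act e VW uy
                 | exists (act a b c d w); apply: edge_actN e VW yw].
Qed.

(** * Runs of smooth cones *)

(** The map is the inverse of the matrix with columns [u] and [v], and [W] is the preimage of [V]
    under that matrix. *)
Lemma std_coord V (u v : vec) : polygon V -> det2 u v = 1 ->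
  exists a b c d W, [/\ a * d - b * c = 1, equiv_act a b c d V W, polygon W,
    act a b c d u = (1, 0) & act a b c d v = (0, 1)].
Proof.
move=> PV uv; exists v.2, (- v.1), (- u.2), u.1.
have e : v.2 * u.1 - - v.1 * - u.2 = 1 by move: uv; rewrite /det2; lia.
have VW : equiv_act v.2 (- v.1) (- u.2) u.1 V
    (fun y => V (act (1 * u.1) (- (1 * - v.1)) (- (1 * - u.2)) (1 * v.2) y)).
  by move=> z; rewrite (act_invr z e).
eexists; split; [exact: e|exact: VW|apply: polygon_act VW PV; by left|..].
  by apply: vec_eq; rewrite /act /=; move: uv; rewrite /det2; lia.
by apply: vec_eq; rewrite /act /=; move: uv; rewrite /det2; lia.
Qed.

(** The orientation-reversing counterpart of [std_coord], for reading a run of smooth cones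
    backwards. *)
Lemma std_coordN V (u v : vec) : polygon V -> det2 u v = 1 ->
  exists a b c d W, [/\ a * d - b * c = -1, equiv_act a b c d V W, polygon W,
    act a b c d v = (1, 0) & act a b c d u = (0, 1)].
Proof.
move=> PV uv; exists (- u.2), u.1, v.2, (- v.1).
have e : - u.2 * - v.1 - u.1 * v.2 = -1 by move: uv; rewrite /det2; lia.
have VW : equiv_act (- u.2) u.1 v.2 (- v.1) V
    (fun y => V (act (-1 * - v.1) (- (-1 * u.1)) (- (-1 * v.2)) (-1 * - u.2) y)).
  by move=> z; rewrite (act_invr z e).
eexists; split; [exact: e|exact: VW|apply: polygon_act VW PV; by right|..].
  by apply: vec_eq; rewrite /act /=; move: uv; rewrite /det2; lia.
by apply: vec_eq; rewrite /act /=; move: uv; rewrite /det2; lia.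
Qed.

Lemma smooth_act a b c d V W u v : a * d - b * c = 1 -> equiv_act a b c d V W ->
  smooth_edge V u v -> smooth_edge W (act a b c d u) (act a b c d v).
Proof.
by move=> e VW [uv uv1]; split; [exact: edge_act uv|rewrite det2_act e uv1].
Qed.

Lemma singular_act a b c d V W u v : a * d - b * c = 1 -> equiv_act a b c d V W ->
  singular_edge V u v -> singular_edge W (act a b c d u) (act a b c d v).
Proof.
by move=> e VW [uv uv1]; split; [exact: edge_act uv|rewrite det2_act e mul1r].
Qed.

Lemma smooth_actN a b c d V W u v : a * d - b * c = -1 -> equiv_act a b c d V W ->
  smooth_edge V u v -> smooth_edge W (act a b c d v) (act a b c d u).
Proof.
move=> e VW [uv uv1]; split; first exact: edge_actN uv.
by rewrite det2_act e; move: uv1; rewrite /det2; lia.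
Qed.

Lemma singular_actN a b c d V W u v : a * d - b * c = -1 -> equiv_act a b c d V W ->
  singular_edge V u v -> singular_edge W (act a b c d v) (act a b c d u).
Proof.
move=> e VW [uv uv1]; split; first exact: edge_actN uv.
by rewrite det2_act e; move: uv1; rewrite /det2; lia.
Qed.

(** Integrality turns the strict bound by 1 into a bound by 0. *)
Lemma smooth_le0 V u v z : smooth_edge V u v -> V z -> z != u -> z != v ->
  det2 u z + det2 z v <= 0.
Proof. by case=> [[_ _ _ uvP] E] Vz zu zv; have := uvP z Vz zu zv; lia. Qed.

Lemma edge_src V u v : edge V u v -> V u. Proof. by case. Qed.

Lemma edge_dst V u v : edge V u v -> V v. Proof. by case. Qed.

Lemma mulz_eq1 (k x : int) : k * x = 1 -> x = 1 \/ x = -1.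
Proof.
move=> /(congr1 absz)/eqP; rewrite abszM muln_eq1 => /andP[_].
by case: x => [[|[|n]]|[|n]] // _; [left|right].
Qed.

Lemma mulz_neq1 (k x : int) : 2 <= x -> k * x = 1 -> False.
Proof. by move=> x2 /mulz_eq1; lia. Qed.

Lemma bezout_diag V x y : polygon V -> V (x, y) -> x + y = 0 ->
  x = 1 \/ x = -1.
Proof.
move=> PV Vz xy; have [[s [t E]] _ _] := PV _ Vz; move: E.
have -> : y = - x by lia.
by move=> E; apply: (@mulz_eq1 (s - t)); rewrite -E /=; ring.
Qed.

(* Two disjoint smooth cones: the matrix [[-a, c], [b, -f]] of (v3, v4) in the
   basis (u, v) and its inverse have nonpositive column sums. *)
Lemma smooth_square V u v v3 v4 : smooth_edge V u v -> smooth_edge V v3 v4 ->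
  2 <= det2 v v3 -> 2 <= det2 v4 u -> False.
Proof.
move=> uv v34 d1 d2.
have [Eu Ev] := (edge_src uv.1, edge_dst uv.1).
have [Ev3 Ev4] := (edge_src v34.1, edge_dst v34.1).
have n3v : v3 != v by rewrite eq_sym; apply: neq_det; lia.
have n4u : v4 != u by apply: neq_det; lia.
have n3u : v3 != u.
  by apply: contraTneq d1 => ->; have := uv.2; rewrite /det2; lia.
have n4v : v4 != v.
  by apply: contraTneq d2 => ->; have := uv.2; rewrite /det2; lia.
have h1 := smooth_le0 uv Ev3 n3u n3v.
have h2 := smooth_le0 uv Ev4 n4u n4v.
have h3 : det2 v3 u + det2 u v4 <= 0 by apply: (smooth_le0 v34 Eu); rewrite eq_sym.
have h4 : det2 v3 v + det2 v v4 <= 0 by apply: (smooth_le0 v34 Ev); rewrite eq_sym.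
have := det2_plucker u v v3 v4; rewrite uv.2 v34.2.
have D x y : det2 x y = - det2 y x by rewrite /det2; ring.
rewrite (D u v4) (D v v4) (D v3 v) in h1 h2 h3 h4 *; rewrite (D v3 u) in h3.
move: h1 h2 h3 h4 d1 d2.
move: (det2 v v3) (det2 u v3) (det2 v4 u) (det2 v4 v) => a b f c.
move=> h1 h2 h3 h4 a2 f2 P.
have {}P : a * f = 1 + b * c by lia.
(* Equality in any of the four bounds would make a number that is at least 2 divide 1. Once all four
   are improved by one, [b * c] is at most [(a - 1) * (f - 1)], which is too small for
   [a * f = 1 + b * c]. *)
have ba : b <= a - 1.
  have [|] := leP a b; [move=> ?; exfalso | lia].
  have E : b = a by lia.
  by rewrite E in P; apply: (@mulz_neq1 (f - c) a); lia.
have cf : c <= f - 1.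
  have [|] := leP f c; [move=> ?; exfalso | lia].
  have E : c = f by lia.
  by rewrite E in P; apply: (@mulz_neq1 (a - b) f); lia.
have bf : - f + 1 <= b.
  have [|] := leP b (- f); [move=> ?; exfalso | lia].
  have E : b = - f by lia.
  by rewrite E in P; apply: (@mulz_neq1 (a + c) f); lia.
have ca : - a + 1 <= c.
  have [|] := leP c (- a); [move=> ?; exfalso | lia].
  have E : c = - a by lia.
  by rewrite E in P; apply: (@mulz_neq1 (f + b) a); lia.
by have [b0|b0] := leP 0 b; nia.
Qed.

(** The relation between three consecutive rays, with its coefficient a_i identified as
    [det2 u w]. *)
Lemma smooth_third u v w : det2 u v = 1 -> det2 v w = 1 ->
  w = (det2 u w * v.1 - u.1, det2 u w * v.2 - u.2).
Proof.
move=> uv vw; apply: vec_eq => /=.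
  transitivity (w.1 * det2 u v + u.1 * (det2 v w - 1)); first by rewrite uv vw; ring.
  by rewrite /det2; ring.
transitivity (w.2 * det2 u v + u.2 * (det2 v w - 1)); first by rewrite uv vw; ring.
by rewrite /det2; ring.
Qed.

Lemma smooth_run2 V z2 : smooth_edge V (1, 0) (0, 1) ->
  smooth_edge V (0, 1) z2 -> exists2 a, a <= 1 & z2 = (-1, a).
Proof.
move=> h01 h12; have := smooth_third h01.2 h12.2.
move: (det2 _ z2) => a E; exists a; last by rewrite E; congr pair => /=; lia.
have h : det2 (0, 1) (1, 0) + det2 (1, 0) z2 <= 0.
  apply: (smooth_le0 h12 (edge_src h01.1)) => //.
  by rewrite E; apply/eqP => -[] /=; lia.
by move: h; rewrite E /det2 /=; lia.
Qed.

Lemma smooth_run3 V z2 z3 : smooth_edge V (1, 0) (0, 1) ->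
  smooth_edge V (0, 1) z2 -> smooth_edge V z2 z3 -> z3 != (1, 0) ->
  exists a b, [/\ a <= 1, b <= 1, b * (a - 1) <= 1, a * (b - 1) <= 1 &
    z2 = (-1, a) /\ z3 = (- b, a * b - 1)].
Proof.
move=> h01 h12 h23 n31; have [a a1 E2] := smooth_run2 h01 h12.
have := smooth_third h12.2 h23.2; move: (det2 _ z3) => b.
rewrite {1 2}E2 /= => E3; exists a, b.
have {}E3 : z3 = (- b, a * b - 1) by rewrite E3; congr pair; lia.
have V3 := edge_dst h23.1.
have n32 : z3 != (0, 1).
  by apply/eqP => E; have := h12.2; have := h23.2; rewrite E /det2 /=; lia.
have n12 : (1, 0) != z2 by rewrite E2; apply/eqP => -[].
have n22 : (0, 1) != z2 by rewrite E2; apply/eqP => -[].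
have := smooth_le0 h01 V3 n31 n32.
have := smooth_le0 h23 (edge_src h01.1) n12; rewrite eq_sym n31 => /(_ isT).
have := smooth_le0 h23 (edge_src h12.1) n22; rewrite eq_sym n32 => /(_ isT).
by rewrite E2 E3 /det2 /= => ? ? ?; split=> //; lia.
Qed.

(** The alternatives say that the coefficient at [z2], respectively at (0, 1), equals 1. Otherwise
    both are nonpositive, and [smooth_run3] leaves only a few pairs, which the next vertex [v]
    refutes. *)
Lemma smooth_run3_singular V z2 z3 v : polygon V -> smooth_edge V (1, 0) (0, 1) ->
  smooth_edge V (0, 1) z2 -> smooth_edge V z2 z3 -> singular_edge V z3 v ->
  v != (1, 0) ->
  (exists2 a, a <= 1 & z2 = (-1, a) /\ z3 = (-1, a - 1)) \/ z2 = (-1, 1).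
Proof.
move=> PV h01 h12 h23 h3v nv1.
have n31 : z3 != (1, 0).
  apply: contraNneq nv1 => E; move: h3v; rewrite E => h.
  by have := edge_succ_inj h.1 h01.1; have := h.2; move=> + e; rewrite e; case: h01 => _ ->.
have [a [b [a1 b1 h1 h2 [E2 E3]]]] := smooth_run3 h01 h12 h23 n31.
have [b_eq|b_neq] := eqVneq b 1.
  by left; exists a => //; rewrite E2 E3; split=> //; congr pair; lia.
have [a_eq|a_neq] := eqVneq a 1; first by right; rewrite E2 a_eq.
exfalso.
have Vv := edge_dst h3v.1.
have nv2 : v != (0, 1).
  apply/eqP => E; have := edge_pred_inj h01.1; rewrite -E => /(_ _ h3v.1) E'.
  by rewrite -E' eqxx in n31.
have nv3 : v != z2.
  apply/eqP => E; have := edge_pred_inj h12.1; rewrite -E => /(_ _ h3v.1) E'.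
  by have := h12.2; have := h23.2; rewrite -E' /det2 /=; lia.
have nv4 : v != z3 by rewrite eq_sym; apply: edge_neq h3v.1.
have := smooth_le0 h01 Vv nv1 nv2; have := smooth_le0 h23 Vv nv3 nv4.
have [_] := h3v; have := @bezout_diag V v.1 v.2 PV; rewrite -surjective_pairing => /(_ Vv).
rewrite E2 E3 /det2 /=; move: (v.1) (v.2) => x y D d l1 l2.
have [a0|a0] : a = 0 \/ a <= -1 by lia.
  rewrite a0 in d l1 h1 l2 *.
  have [b0|b0] : b = 0 \/ b = -1 by lia.
    (* For [a = b = 0] the run is (1, 0), (0, 1), (-1, 0), (0, -1), and convexity still allows x + y
       = 0. Primitivity then gives x = 1 or x = -1, while the singular cone requires x >= 2. *)
    by rewrite b0 in d l1 *; have /D : x + y = 0; lia.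
  by rewrite b0 in d l1 *; lia.
have [b0|b0] : b = 0 \/ b <= -1 by lia.
  rewrite b0 in d l1 h2 *; have a_1 : a = -1 by lia.
  by rewrite a_1 in d l1 *; lia.
nia.
Qed.

(** The run is (1, 0), (0, 1), (-1, a), (-b, ab - 1), (1 - bc, c(ab - 1) - a), and (x, y) is the
    vertex before (1, 0). The bound on [y] says that the cone between these two is singular, and
    [x + y <= -1] combines convexity with primitivity. The other hypotheses place vertices on the
    origin's side of smooth edges. *)
Lemma run4_arith (a b c x y : int) : a <= 1 -> b <= 1 -> c <= 1 ->
  b * (a - 1) <= 1 -> a * (b - 1) <= 1 -> c * (b - 1) <= 1 -> b * (c - 1) <= 1 ->
  y <= -2 -> x + y <= -1 -> x * (a - 1) + y <= 0 ->
  x * (a * b - 1 - a) + y * (b - 1) <= 0 ->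
  x * (c * (a * b - 1) - a - (a * b - 1)) + y * (c * b - 1 - b) <= 0 -> False.
Proof.
move=> a1 b1 c1 ba ab cb bc d l01 l12 l23 l34.
have [b_1|b0] : b = 1 \/ b <= 0 by lia.
  subst b; have x0 : 0 <= x by lia.
  have : (2 - c) * (- y) <= x * (1 - (2 - c) * (1 - a)) by lia.
  have : 1 <= 2 - c by lia.
  have : 0 <= 1 - a by lia.
  have [->|a0] : a = 1 \/ 1 <= 1 - a by lia.
    clear - l01 d x0; nia.
  move: (2 - c) (1 - a) a0 => m n n1 _ m1.
  clear - n1 m1 x0 d; have : 1 <= m * n by nia.
  nia.
have [|[|b2]] : b = 0 \/ b = -1 \/ b <= -2 by lia.
- move=> ?; subst b.
  have A : a = -1 \/ a = 0 \/ a = 1 by lia.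
  have C : c = -1 \/ c = 0 \/ c = 1 by lia.
  by move: A C => [?|[?|?]] [?|[?|?]]; subst; lia.
- move=> ?; subst b.
  have A : a = 0 \/ a = 1 by lia.
  have C : c = 0 \/ c = 1 by lia.
  by move: A C => [?|?] [?|?]; subst; lia.
have ? : a = 1 by clear - ba a1 b2; nia.
have ? : c = 1 by clear - bc c1 b2; nia.
by subst a c; lia.
Qed.

Lemma singular_smooth_pred V u v w : singular_edge V u w -> smooth_edge V v w -> False.
Proof. by move=> [uw d] [vw e]; have E := edge_pred_inj uw vw; rewrite E e in d. Qed.

(** The condition [z != z4] sets aside a cycle closed by a single singular cone. *)
Lemma smooth_run4 V z z2 z3 z4 : polygon V -> singular_edge V z (1, 0) ->
  smooth_edge V (1, 0) (0, 1) -> smooth_edge V (0, 1) z2 -> smooth_edge V z2 z3 ->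
  smooth_edge V z3 z4 -> z != z4 -> False.
Proof.
move=> PV hz h01 h12 h23 h34 nz4.
have n31 : z3 != (1, 0).
  by apply/eqP => E; apply: (singular_smooth_pred hz (v := z2)); rewrite -E.
have n41 : z4 != (1, 0).
  by apply/eqP => E; apply: (singular_smooth_pred hz (v := z3)); rewrite -E.
have n42 : z4 != (0, 1).
  apply/eqP => E; have := edge_pred_inj h01.1; rewrite -E => /(_ _ h34.1) E'.
  by rewrite -E' eqxx in n31.
have n43 : z4 != z2.
  apply/eqP => E; have := h34.2; have := h23.2; rewrite E /det2; lia.
have nz2 : z != (0, 1).
  by apply/eqP => E; have := hz.2; rewrite E.
have nz3 : z != z2.
  apply/eqP => E; have := edge_succ_inj hz.1; rewrite E => /(_ _ h23.1) E'.
  by rewrite -E' eqxx in n31.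
have nz5 : z != z3.
  apply/eqP => E; have := edge_succ_inj hz.1; rewrite E => /(_ _ h34.1) E'.
  by rewrite -E' eqxx in n41.
have nz1 : z != (1, 0) := edge_neq hz.1.
have [a [b [a1 b1 ba ab [E2 E3]]]] := smooth_run3 h01 h12 h23 n31.
have := smooth_third h23.2 h34.2; move: (det2 _ z4) => c.
rewrite {1 2}E2 {1 2}E3 /= => E4.
have {}E4 : z4 = (- (c * b) + 1, c * (a * b - 1) - a) by rewrite E4; congr pair; lia.
have Vz := edge_src hz.1.
have V1 := edge_src h01.1.
have V2 := edge_src h12.1.
have V3 := edge_src h23.1.
have V4 := edge_src h34.1.
have V5 := edge_dst h34.1.
have := smooth_le0 h01 V5 n41 n42.
have : det2 (0, 1) z4 + det2 z4 z2 <= 0 by apply: (smooth_le0 h12 V5).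
have : det2 z3 z2 + det2 z2 z4 <= 0.
  by apply: (smooth_le0 h34 V3); [apply: edge_neq h23.1|rewrite eq_sym].
have : det2 z3 (0, 1) + det2 (0, 1) z4 <= 0.
  apply: (smooth_le0 h34 V2); rewrite eq_sym //.
  by apply/eqP => E; have := h12.2; have := h23.2; rewrite E /det2 /=; lia.
have := smooth_le0 h01 Vz nz1 nz2.
have := smooth_le0 h12 Vz nz2 nz3.
have := smooth_le0 h23 Vz nz3 nz5.
have := smooth_le0 h34 Vz nz5 nz4.
have := hz.2; have := @bezout_diag V z.1 z.2 PV; rewrite -surjective_pairing => /(_ Vz).
rewrite E2 E3 E4 /det2 /= => D d l34 l23 l12 l01 k1 k2 k3 k4.
move: D d l34 l23 l12 l01 k1 k2 k3 k4; move: (z.1) (z.2) => x y.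
clear - a1 b1 ba ab => D d l34 l23 l12 l01 k1 k2 k3 k4.
apply: (@run4_arith a b c x y) => //; lia.
Qed.

(** * Excluding smooth cones on both arcs *)

Ltac neq_of U :=
  apply: contraTneq U => ->; rewrite /= !inE ?eqxx ?orbT /= ?andbF //.

Lemma act_inj a b c d : a * d - b * c = 1 \/ a * d - b * c = -1 ->
  injective (act a b c d).
Proof.
move=> e x y xy; case: e => e.
  by rewrite -(act_invr x e (mulr1 1)) xy (act_invr y e (mulr1 1)).
have N : -1 * -1 = 1 :> int by [].
by rewrite -(act_invr x e N) xy (act_invr y e N).
Qed.

(* In the lemmas named runkl the two arcs between the singular cones carry k and l
   smooth cones. *)
Lemma run21_std V z w3 w4 : polygon V ->
  uniq [:: z; (1, 0); (0, 1); w3; w4] ->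
  smooth_edge V z (1, 0) -> smooth_edge V (1, 0) (0, 1) ->
  singular_edge V (0, 1) w3 -> smooth_edge V w3 w4 -> singular_edge V w4 z -> False.
Proof.
move=> PV U hz h01 h1 h34 h4.
(* The isolated smooth cone is compared with each of the two cones of the longer run. In the
   coordinates w3 = (-a, b), w4 = (c, -f) introduced below, this yields [f <= 1] and [b <= 1]. *)
have sq1 := smooth_square h01 h34 h1.2.
have : ~ (2 <= det2 (1, 0) w3).
  by move=> l; apply: (smooth_square hz h34 l h4.2).
have V3 := edge_src h34.1.
have V4 := edge_dst h34.1.
have Vz := edge_src hz.1.
have V1 := edge_src h01.1.
have V2 := edge_dst h01.1.
have n1 : w3 != (1, 0) by neq_of U.
have n2 : w3 != (0, 1) by neq_of U.
have n3 : w4 != (1, 0) by neq_of U.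
have n4 : w4 != (0, 1) by neq_of U.
have n5 : z != w3 by neq_of U.
have n6 : z != w4 by neq_of U.
have n7 : (0, 1) != z by neq_of U.
have l1 := smooth_le0 h01 V3 n1 n2.
have l2 := smooth_le0 h01 V4 n3 n4.
have l3 := smooth_le0 h34 Vz n5 n6.
have l4 : det2 z (0, 1) + det2 (0, 1) (1, 0) <= 0 by apply: (smooth_le0 hz).
have l5 : det2 w3 (1, 0) + det2 (1, 0) w4 <= 0.
  by apply: (smooth_le0 h34); rewrite // eq_sym.
have l6 : det2 w3 (0, 1) + det2 (0, 1) w4 <= 0.
  by apply: (smooth_le0 h34); rewrite // eq_sym.
move: sq1 hz.2 h34.2 h1.2 h4.2 l1 l2 l3 l4 l5 l6.
case: z w3 w4 {hz h1 h34 h4 V3 V4 Vz U n1 n2 n3 n4 n5 n6 n7} => [x0 y0] [a' b] [c f'].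
have [a ->] : exists a, a' = - a by exists (- a'); lia.
have [f ->] : exists f, f' = - f by exists (- f'); lia.
rewrite /det2 /= => sq1 ? e34 a2 d l1 l2 l3 l4 l5 l6 sq2.
have ? : y0 = -1 by lia.
subst y0.
have f1 : - 1 <= f by rewrite leNgt; apply/negP => ?; apply: sq1; lia.
have b1 : b <= 1 by rewrite leNgt; apply/negP => ?; apply: sq2; lia.
have {}e34 : a * f = 1 + b * c by lia.
have [?|[?|f2]] : f = -1 \/ f = 0 \/ 1 <= f by lia.
- subst f; have [?|[?|?]] : b = 1 \/ b = 0 \/ b <= -1 by lia.
  + by subst b; nia.
  + by subst b; nia.
  + have ? : b = -1 by lia.
    by subst b; nia.
- subst f; have [?|[?|?]] : b = 1 \/ b = 0 \/ b <= -1 by lia.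
  + by subst b; nia.
  + by subst b; nia.
  + by nia.
- have [?|[?|?]] : b = 1 \/ b = 0 \/ b <= -1 by lia.
  + by subst b; nia.
  + by subst b; nia.
  + by nia.
Qed.

(** With w4 = (c, -f) the sign assumption reads [0 <= f], and [smooth_square] gives [f <= 1], so two
    values of [f] remain. The assumption is arranged by symmetry in [run22]. *)
Lemma run22_std V z w3 w4 w5 : polygon V ->
  uniq [:: z; (1, 0); (0, 1); w3; w4; w5] ->
  smooth_edge V z (1, 0) -> smooth_edge V (1, 0) (0, 1) ->
  singular_edge V (0, 1) w3 -> smooth_edge V w3 w4 -> smooth_edge V w4 w5 ->
  singular_edge V w5 z -> 0 <= det2 w4 (1, 0) -> False.
Proof.
move=> PV U hz h01 h1 h34 h45 h5.
have sq1 := smooth_square h01 h34 h1.2.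
have V3 := edge_src h34.1.
have V4 := edge_dst h34.1.
have V5 := edge_dst h45.1.
have Vz := edge_src hz.1.
have V1 := edge_src h01.1.
have V2 := edge_dst h01.1.
have n1 : w3 != (1, 0) by neq_of U.
have n2 : w3 != (0, 1) by neq_of U.
have n3 : w4 != (1, 0) by neq_of U.
have n4 : w4 != (0, 1) by neq_of U.
have n5 : z != w3 by neq_of U.
have n6 : z != w4 by neq_of U.
have n7 : (0, 1) != z by neq_of U.
have n8 : w5 != (1, 0) by neq_of U.
have n9 : w5 != (0, 1) by neq_of U.
have n10 : w5 != w3 by neq_of U.
have n11 : w5 != w4 by neq_of U.
have l1 := smooth_le0 h01 V3 n1 n2.
have l2 := smooth_le0 h01 V4 n3 n4.
have l3 := smooth_le0 h34 Vz n5 n6.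
have l4 : det2 z (0, 1) + det2 (0, 1) (1, 0) <= 0 by apply: (smooth_le0 hz).
have l5 : det2 w3 (1, 0) + det2 (1, 0) w4 <= 0.
  by apply: (smooth_le0 h34); rewrite // eq_sym.
have l6 : det2 w3 (0, 1) + det2 (0, 1) w4 <= 0.
  by apply: (smooth_le0 h34); rewrite // eq_sym.
have l7 := smooth_le0 h01 V5 n8 n9.
have l8 := smooth_le0 h34 V5 n10 n11.
move: sq1 hz.2 h34.2 h45.2 h1.2 h5.2 l1 l2 l3 l4 l5 l6 l7 l8.
case: z w3 w4 w5 {hz h1 h34 h45 h5 V3 V4 V5 Vz U n1 n2 n3 n4 n5 n6 n7 n8 n9 n10 n11} =>
  [x0 y0] [a' b] [c f'] [s t].
have [a ->] : exists a, a' = - a by exists (- a'); lia.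
have [f ->] : exists f, f' = - f by exists (- f'); lia.
rewrite /det2 /= => sq1 ? e34 e45 a2 d l1 l2 l3 l4 l5 l6 l7 l8 f0.
have ? : y0 = -1 by lia.
subst y0.
have f1 : f <= 1 by rewrite leNgt; apply/negP => ?; apply: sq1; lia.
have {}e34 : a * f = 1 + b * c by lia.
have [?|?] : f = 1 \/ f = 0 by lia.
- subst f; have [?|?] : b = -1 \/ 0 <= b by lia.
  + by subst b; nia.
  + have ? : c = 1 by nia.
    by subst c; lia.
- subst f; have [? ?] : b = 1 /\ c = -1 by nia.
  by subst b c; nia.
Qed.

Lemma run4 V u v0 v1 v2 v3 v4 : polygon V -> singular_edge V u v0 ->
  smooth_edge V v0 v1 -> smooth_edge V v1 v2 -> smooth_edge V v2 v3 ->
  smooth_edge V v3 v4 -> u != v4 -> False.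
Proof.
move=> PV hu h01 h12 h23 h34 u4.
have [a [b [c [d [W [e VW PW E0 E1]]]]]] := std_coord PV h01.2.
have := singular_act e VW hu; have := smooth_act e VW h01.
have := smooth_act e VW h12; have := smooth_act e VW h23.
have := smooth_act e VW h34; rewrite E0 E1 => {}h34 {}h23 {}h12 {}h01 {}hu.
apply: (smooth_run4 PW hu h01 h12 h23 h34).
by rewrite (inj_eq (act_inj (or_introl e))).
Qed.

Lemma run21 V v0 v1 v2 w0 w1 : polygon V -> uniq [:: v0; v1; v2; w0; w1] ->
  smooth_edge V v0 v1 -> smooth_edge V v1 v2 -> singular_edge V v2 w0 ->
  smooth_edge V w0 w1 -> singular_edge V w1 v0 -> False.
Proof.
move=> PV U h01 h12 h2 k01 k1.
have [a [b [c [d [W [e VW PW E0 E1]]]]]] := std_coord PV h12.2.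
move: U; rewrite -(map_inj_uniq (act_inj (or_introl e))) /=.
have := smooth_act e VW h01; have := smooth_act e VW h12.
have := singular_act e VW h2; have := smooth_act e VW k01.
have := singular_act e VW k1; rewrite E0 E1 => {}k1 {}k01 {}h2 {}h12 {}h01 U.
exact: (run21_std PW U h01 h12 h2 k01 k1).
Qed.

(** Exchanging the two runs negates the determinant of their middle vertices, which may therefore be
    taken nonnegative. *)
Lemma run22 V v0 v1 v2 w0 w1 w2 : polygon V -> uniq [:: v0; v1; v2; w0; w1; w2] ->
  smooth_edge V v0 v1 -> smooth_edge V v1 v2 -> singular_edge V v2 w0 ->
  smooth_edge V w0 w1 -> smooth_edge V w1 w2 -> singular_edge V w2 v0 -> False.
Proof.
move=> PV; wlog d0 : v0 v1 v2 w0 w1 w2 / 0 <= det2 w1 v1.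
  move=> H U h01 h12 h2 k01 k12 k2.
  have [d0|d0] := leP 0 (det2 w1 v1); first exact: (H v0 v1 v2 w0 w1 w2).
  apply: (H w0 w1 w2 v0 v1 v2) => //; first by move: d0; rewrite /det2; lia.
  by rewrite -(rot_uniq 3) in U.
move=> U h01 h12 h2 k01 k12 k2.
have [a [b [c [d [W [e VW PW E0 E1]]]]]] := std_coord PV h12.2.
move: U d0; rewrite -(map_inj_uniq (act_inj (or_introl e))) /=.
rewrite -[det2 _ _]mul1r -e -det2_act.
have := smooth_act e VW h01; have := smooth_act e VW h12.
have := singular_act e VW h2; have := smooth_act e VW k01.
have := smooth_act e VW k12.
have := singular_act e VW k2; rewrite E0 E1 => {}k2 {}k12 {}k01 {}h2 {}h12 {}h01 U d0.
exact: (run22_std PW U h01 h12 h2 k01 k12 k2).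
Qed.

(** By [smooth_third], one of the two inner rays of the run is the sum of its neighbours. The
    alternatives are mirror images: later arguments settle the first directly and reach the second
    through [std_coordN]. *)
Lemma run3_turn V v0 v1 v2 v3 w : polygon V -> smooth_edge V v0 v1 ->
  smooth_edge V v1 v2 -> smooth_edge V v2 v3 -> singular_edge V v3 w -> w != v0 ->
  det2 v1 v3 = 1 \/ det2 v0 v2 = 1.
Proof.
move=> PV h01 h12 h23 h3 w0.
have [a [b [c [d [W [e VW PW E0 E1]]]]]] := std_coord PV h01.2.
rewrite -[det2 v1 _]mul1r -[det2 v0 _]mul1r -e -!det2_act.
move: w0; rewrite -(inj_eq (act_inj (or_introl e))).
have := smooth_act e VW h01; have := smooth_act e VW h12.
have := smooth_act e VW h23; have := singular_act e VW h3.
rewrite E0 E1 => {}h3 {}h23 {}h12 {}h01 w0.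
have [[x _ [E2 E3]]|E2] := smooth_run3_singular PW h01 h12 h23 h3 w0.
  by left; rewrite E3 /det2 /=; lia.
by right; rewrite E2 /det2 /=; lia.
Qed.

Lemma smooth_run3_std V z2 z3 : smooth_edge V (1, 0) (0, 1) ->
  smooth_edge V (0, 1) z2 -> smooth_edge V z2 z3 -> det2 (0, 1) z3 = 1 ->
  exists2 a, a <= 1 & z2 = (-1, a) /\ z3 = (-1, a - 1).
Proof.
move=> h01 h12 h23 b1; have [a a1 E2] := smooth_run2 h01 h12; exists a => //.
split=> //; have := smooth_third h12.2 h23.2; rewrite b1 E2 => ->.
by congr pair => /=; lia.
Qed.

Lemma run31_std V z2 z3 w w' : polygon V ->
  uniq [:: (1, 0); (0, 1); z2; z3; w; w'] ->
  smooth_edge V (1, 0) (0, 1) -> smooth_edge V (0, 1) z2 -> smooth_edge V z2 z3 ->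
  det2 (0, 1) z3 = 1 -> singular_edge V z3 w -> smooth_edge V w w' -> False.
Proof.
move=> PV U h01 h12 h23 b1 h3 hw.
have [a a1 [E2 E3]] := smooth_run3_std h01 h12 h23 b1.
have Vw := edge_src hw.1.
have Vw' := edge_dst hw.1.
have n1 : w != (1, 0) by neq_of U.
have n2 : w != (0, 1) by neq_of U.
have n3 : w != z2 by neq_of U.
have n4 : w != z3 by neq_of U.
have n5 : w' != (1, 0) by neq_of U.
have n6 : w' != (0, 1) by neq_of U.
have n7 : w' != z2 by neq_of U.
have n8 : w' != z3 by neq_of U.
have l1 := smooth_le0 h01 Vw n1 n2.
have l2 := smooth_le0 h01 Vw' n5 n6.
have l3 := smooth_le0 h23 Vw n3 n4.
have l4 := smooth_le0 h23 Vw' n7 n8.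
have l5 : det2 w (1, 0) + det2 (1, 0) w' <= 0.
  by apply: (smooth_le0 hw (edge_src h01.1)); rewrite // eq_sym.
have l6 : det2 w z3 + det2 z3 w' <= 0.
  by apply: (smooth_le0 hw (edge_src h3.1)); rewrite // eq_sym.
move: l1 l2 l3 l4 l5 l6 hw.2 h3.2; rewrite E2 E3.
case: w w' {hw U Vw Vw' h3 n1 n2 n3 n4 n5 n6 n7 n8} => [x y] [x' y'].
rewrite /det2 /= => l1 l2 l3 l4 l5 l6 e d.
have {}l3 : 0 <= x by lia.
have {}l4 : 0 <= x' by lia.
have [?|a0] : a = 1 \/ a <= 0 by lia.
  subst a; have ? : y' = y by lia.
  by subst y'; case: (@mulz_neq1 (x' - x) (- y)); lia.
(* Now [det2 w w' = x * (y' - y) + y * (x - x')] has no positive term, since y <= -x <= 0; but it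
   should be 1. *)
have : x' <= x by nia.
by move=> ?; nia.
Qed.

(** Only the smooth cone of the other arc nearest to the run is used, on one side or, after
    mirroring, on the other. Hence the two lists, and hence one statement for an arc of one, two or
    three smooth cones. *)
Lemma run31 V v0 v1 v2 v3 w w' u u' : polygon V ->
  uniq [:: v0; v1; v2; v3; w; w'] -> uniq [:: v3; v2; v1; v0; u; u'] ->
  smooth_edge V v0 v1 -> smooth_edge V v1 v2 -> smooth_edge V v2 v3 ->
  singular_edge V v3 w -> smooth_edge V w w' ->
  smooth_edge V u' u -> singular_edge V u v0 -> False.
Proof.
move=> PV U U' h01 h12 h23 h3 hw hu h0.
have w0 : w != v0 by neq_of U.
have [t|t] := run3_turn PV h01 h12 h23 h3 w0.
  have [a [b [c [d [W [e VW PW E0 E1]]]]]] := std_coord PV h01.2.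
  have {}t : det2 (act a b c d v1) (act a b c d v3) = 1 by rewrite det2_act e t.
  move: U t; rewrite -(map_inj_uniq (act_inj (or_introl e))) /=.
  have := smooth_act e VW h01; have := smooth_act e VW h12.
  have := smooth_act e VW h23; have := singular_act e VW h3.
  have := smooth_act e VW hw.
  rewrite E0 E1 => {}hw {}h3 {}h23 {}h12 {}h01 U t.
  exact: (run31_std PW U h01 h12 h23 t h3 hw).
have [a [b [c [d [W [e VW PW E0 E1]]]]]] := std_coordN PV h23.2.
move: U' t; rewrite -(map_inj_uniq (act_inj (or_intror e))) /=.
have := smooth_actN e VW h01; have := smooth_actN e VW h12.
have := smooth_actN e VW h23; have := singular_actN e VW h0.
have := smooth_actN e VW hu.
rewrite E0 E1 => {}hu {}h0 {}h23 {}h12 {}h01 U' t.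
apply: (run31_std PW U' h23 h12 h01 _ h0 hu).
rewrite -E1 det2_act e; move: t; rewrite /det2; lia.
Qed.

(** * Classification of the integral polygons *)

Fixpoint smooth_path (V : vec -> Prop) (u : vec) (s : seq vec) : Prop :=
  if s is v :: s' then smooth_edge V u v /\ smooth_path V v s' else True.

Lemma smooth_not_singular V u v w : smooth_edge V u v -> singular_edge V u w -> False.
Proof. by move=> [uv e] [uw d]; have E := edge_succ_inj uv uw; rewrite -E e in d. Qed.

(** Successors are unique and no vertex starts both a smooth and a singular edge, so both paths stop
    at the first vertex that starts a singular one. *)
Lemma smooth_path_inj V u s t w w' : smooth_path V u s -> smooth_path V u t ->
  singular_edge V (last u s) w -> singular_edge V (last u t) w' -> s = t.
Proof.
elim: s u t => [|v s IH] u [|v' t] //=.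
- by move=> _ [uv _] uw; case: (smooth_not_singular uv uw).
- by move=> [uv _] _ _ uw; case: (smooth_not_singular uv uw).
move=> [uv us] [uv' ut] h h'; have E := edge_succ_inj uv.1 uv'.1.
by subst v'; congr cons; apply: IH h h'.
Qed.

Lemma smooth_path_suffix V u s x : smooth_path V u s -> x \in u :: s ->
  exists t, [/\ smooth_path V x t, last x t = last u s & (size t <= size s)%N].
Proof.
elim: s u => [|v s IH] u /=; first by rewrite mem_seq1 => _ /eqP ->; exists [::].
move=> [uv us]; rewrite inE => /predU1P[->|xs]; first by exists (v :: s).
by have [t [xt lt st]] := IH v us xs; exists t; split=> //; apply: leqW.
Qed.

(** A return to [u] would leave a shorter smooth path from [u] with the same end, contrary to
    [smooth_path_inj]. *)
Lemma smooth_path_uniq V u s w : smooth_path V u s -> singular_edge V (last u s) w ->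
  uniq (u :: s).
Proof.
elim: s u => [//|v s IH] u /= [uv us] h.
rewrite -[X in _ && X]/(uniq (v :: s)) (IH v us h) andbT; apply/negP => uvs.
have [t [ut lt st]] := smooth_path_suffix us uvs.
have us' : smooth_path V u (v :: s) by [].
have E := smooth_path_inj ut us'.
by move: st; rewrite (E w w) ?lt //= ltnn.
Qed.

Lemma smooth_path_disjoint V u s v t w w' : smooth_path V u s -> smooth_path V v t ->
  singular_edge V (last u s) w -> singular_edge V (last v t) w' ->
  last u s != last v t -> uniq ((u :: s) ++ (v :: t)).
Proof.
move=> us vt hs ht nst; rewrite cat_uniq (smooth_path_uniq us hs) (smooth_path_uniq vt ht).
rewrite andbT; apply/hasPn => x xt; apply/negP => xs.
have [s' [xs' ls' _]] := smooth_path_suffix us xs.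
have [t' [xt' lt' _]] := smooth_path_suffix vt xt.
have E := smooth_path_inj xs' xt'.
by move: nst; rewrite -ls' -lt' (E w w') ?ls' ?lt' ?eqxx.
Qed.

Lemma singular_succ_neq V u1 v1 u2 v2 : singular_edge V u1 v1 -> singular_edge V u2 v2 ->
  (u1, v1) != (u2, v2) -> u1 != u2.
Proof.
move=> h1 h2; apply: contraNneq => E; subst u2.
by rewrite (edge_succ_inj h1.1 h2.1).
Qed.

(** [run4] stops the walk from [v1] after at most three smooth steps. Reaching [u1] before [u2]
    would close a chain that misses [u2], contrary to [chain_closed]. *)
Lemma singular_run V u1 v1 u2 : polygon V -> singular_edge V u1 v1 -> V u2 ->
  u1 != u2 -> (forall u v, edge V u v -> u != u1 -> u != u2 -> det2 u v = 1) ->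
  exists s, [/\ (size s <= 3)%N, smooth_path V v1 s & last v1 s = u2].
Proof.
move=> PV h1 V2 n12 sm.
have next x : V x -> x != u1 -> x != u2 -> exists y, smooth_edge V x y.
  by move=> Vx n1 n2; have [_ [y xy] _] := PV x Vx; exists y; split=> //; apply: sm.
have nv1 : v1 != u1 by rewrite eq_sym; apply: edge_neq h1.1.
have [E|n1] := eqVneq v1 u2; first by exists [::].
have [x1 h01] := next _ (edge_dst h1.1) nv1 n1.
have [E|n2] := eqVneq x1 u2; first by exists [:: x1].
have nx1 : x1 != u1.
  apply/eqP => E; rewrite E in h01; have := @chain_closed V u1 [:: v1] u2 PV.
  by rewrite /= !inE eq_sym (negbTE n12) eq_sym (negbTE n1) => /(_ (conj h1.1 h01.1) V2).
have [x2 h12] := next _ (edge_dst h01.1) nx1 n2.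
have [E|n3] := eqVneq x2 u2; first by exists [:: x1; x2].
have nx2 : x2 != u1.
  apply/eqP => E; rewrite E in h12; have := @chain_closed V u1 [:: v1; x1] u2 PV.
  rewrite /= !inE ![u2 == _]eq_sym (negbTE n12) (negbTE n1) (negbTE n2).
  by move=> /(_ (conj h1.1 (conj h01.1 h12.1)) V2).
have [x3 h23] := next _ (edge_dst h12.1) nx2 n3.
have [E|n4] := eqVneq x3 u2; first by exists [:: x1; x2; x3].
have nx3 : x3 != u1.
  apply/eqP => E; rewrite E in h23; have := @chain_closed V u1 [:: v1; x1; x2] u2 PV.
  rewrite /= !inE ![u2 == _]eq_sym (negbTE n12) (negbTE n1) (negbTE n2) (negbTE n3).
  by move=> /(_ (conj h1.1 (conj h01.1 (conj h12.1 h23.1))) V2).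
have [x4 h34] := next _ (edge_dst h23.1) nx3 n4.
exfalso; apply: (run4 PV h1 h01 h12 h23 h34); apply/eqP => E; rewrite -E in h34.
have := @chain_closed V u1 [:: v1; x1; x2; x3] u2 PV.
rewrite /= !inE ![u2 == _]eq_sym (negbTE n12) (negbTE n1) (negbTE n2).
rewrite (negbTE n3) (negbTE n4).
by move=> /(_ (conj h1.1 (conj h01.1 (conj h12.1 (conj h23.1 h34.1)))) V2).
Qed.

(** * The three model polygons and their recognition *)

Definition triangle p q : seq vec := [:: (1, 0); (0, 1); (- p, - q)].
Definition quadrilateral p q r : seq vec := [:: (1, 0); (0, 1); (-1, p); (q, r)].
Definition pentagon p q r : seq vec :=
  [:: (1, 0); (0, 1); (-1, p + 1); (-1, p); (q, r)].

Definition is_type1 V := exists p q : int, [/\ 2 <= p, 2 <= q, gcdz p q = 1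
  & equivZ V (fun z => z \in triangle p q)].
Definition is_type2 V := exists p q r : int, [/\ p <= 1,
  r <= Num.min (Num.min (- (p * q) - 2) (- 2)) (Num.min (- q - 1) (q - p * q - 1)),
  gcdz q r = 1 & equivZ V (fun z => z \in quadrilateral p q r)].
Definition is_type3 V := exists p q r : int, [/\ p <= 0, 1 <= q <= - r - 1,
  gcdz q r = 1 & equivZ V (fun z => z \in pentagon p q r)].

Lemma chain_mem V u s : chain V u s u -> forall z, z \in u :: s -> V z.
Proof.
suff H w : forall u, chain V u s w -> forall z, z \in u :: s -> V z by move/H.
elim: s => [|v s IH] {}u /=.
  by move=> uw z; rewrite mem_seq1 => /eqP ->; apply: edge_src uw.
by move=> [uv vw] z; rewrite inE => /predU1P[->|]; [apply: edge_src uv | apply: IH].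
Qed.

Lemma chain_vertices V u s : polygon V -> chain V u s u ->
  forall z, V z <-> z \in u :: s.
Proof. by move=> PV us z; split; [apply: chain_closed|apply: chain_mem]. Qed.

Lemma equivZ_chain a b c d V W u s : a * d - b * c = 1 \/ a * d - b * c = -1 ->
  equiv_act a b c d V W -> polygon W -> chain W u s u ->
  equivZ V (fun z => z \in u :: s).
Proof.
move=> e VW PW us; exists a, b, c, d; split=> // z.
by rewrite VW; apply: chain_vertices.
Qed.

Lemma type1P V v0 v1 u : polygon V -> smooth_edge V v0 v1 -> singular_edge V v1 u ->
  singular_edge V u v0 -> is_type1 V.
Proof.
move=> PV h01 h1 hu.
have [a [b [c [d [W [e VW PW E0 E1]]]]]] := std_coord PV h01.2.
have := smooth_act e VW h01; have := singular_act e VW h1; have := singular_act e VW hu.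
rewrite E0 E1; move: (act a b c d u) => [x y] {}hu {}h1 {}h01.
have [bx _ _] := PW _ (edge_src hu.1).
exists (- x), (- y); split.
- by have := h1.2; rewrite /det2 /=; lia.
- by have := hu.2; rewrite /det2 /=; lia.
- by rewrite gcdzN gcdNz; apply/(@gcdz_bezout (x, y)).
rewrite /triangle !opprK; apply: (equivZ_chain (or_introl e) VW PW).
by split; [exact: h01.1|split; [exact: h1.1|exact: hu.1]].
Qed.

(** Origin of the four bounds on [r]: [- (p * q) - 2] and [- 2] express that the two cones at (q, r)
    are singular, while [- q - 1] and [q - p * q - 1] place (q, r) with respect to the two smooth
    edges. Convexity gives the last two without the -1; primitivity excludes equality. *)
Lemma type2P V v0 v1 v2 u : polygon V -> smooth_edge V v0 v1 -> smooth_edge V v1 v2 ->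
  singular_edge V v2 u -> singular_edge V u v0 -> is_type2 V.
Proof.
move=> PV h01 h12 h2 hu.
have [a [b [c [d [W [e VW PW E0 E1]]]]]] := std_coord PV h01.2.
have := smooth_act e VW h01; have := smooth_act e VW h12.
have := singular_act e VW h2; have := singular_act e VW hu.
rewrite E0 E1 => {}hu {}h2 {}h12 {}h01; have [p p1 E2] := smooth_run2 h01 h12.
move: hu h2 h12; rewrite {}E2; move: (act a b c d u) => [q r] {}hu {}h2 {}h12.
have Wu := edge_src hu.1; have [bx _ _] := PW _ Wu.
exists p, q, r; split=> //; last 2 first.
- exact/(@gcdz_bezout (q, r)).
- apply: (equivZ_chain (or_introl e) VW PW).
  by split; [exact: h01.1|split; [exact: h12.1|split; [exact: h2.1|exact: hu.1]]].
have n1 : (q, r) != (1, 0) := edge_neq hu.1.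
have n2 : (q, r) != (-1, p) by rewrite eq_sym; apply: edge_neq h2.1.
have n3 : (q, r) != (0, 1).
  by apply/eqP => -[q0 r1]; have := hu.2; rewrite q0 r1 /det2 /=; lia.
have := smooth_le0 h01 Wu n1 n3; have := smooth_le0 h12 Wu n3 n2.
have := h2.2; have := hu.2; have D := bezout_diag PW Wu.
rewrite /det2 /= => d1 d2 l1 l2.
have qr : q + r <= -1.
  by rewrite leNgt; apply/negP => ?; have /D : q + r = 0; lia.
suff : r <= q - p * q - 1 by lia.
rewrite leNgt; apply/negP => rq.
have Er : r = q * (1 - p) by lia.
move: bx => [s [t /= st]].
have /mulz_eq1 : (s + t * (1 - p)) * q = 1 by rewrite -[RHS]st Er; ring.
by lia.
Qed.

(** The smooth edges on x + y = 1 and on x = -1 give q + r <= 0 and q >= 0. Primitivity of (q, r),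
    together with r <= -2, excludes equality in both. *)
Lemma type3_std V z2 z3 u : polygon V -> smooth_edge V (1, 0) (0, 1) ->
  smooth_edge V (0, 1) z2 -> smooth_edge V z2 z3 -> det2 (0, 1) z3 = 1 ->
  singular_edge V z3 u -> singular_edge V u (1, 0) ->
  exists p q r : int, [/\ p <= 0, 1 <= q <= - r - 1, gcdz q r = 1,
    (-1, p + 1) = z2 & (-1, p) = z3 /\ (q, r) = u].
Proof.
move=> PV h01 h12 h23 b1 h3 hu.
have [a a1 [E2 E3]] := smooth_run3_std h01 h12 h23 b1.
move: u h3 hu => [q r] h3 hu.
have Vu := edge_src hu.1; have [bx _ _] := PV _ Vu.
exists (a - 1), q, r; split; rewrite ?E2 ?E3 //; last 2 first.
- exact/(@gcdz_bezout (q, r)).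
- by congr pair; lia.
- lia.
have n1 : (q, r) != (1, 0) := edge_neq hu.1.
have n2 : (q, r) != (0, 1).
  by apply/eqP => -[q0 r1]; have := hu.2; rewrite q0 r1 /det2 /=; lia.
have n4 : (q, r) != z3 by rewrite eq_sym; apply: edge_neq h3.1.
have n3 : (q, r) != z2.
  apply/eqP => E; have := edge_pred_inj h12.1; rewrite -E => /(_ _ h3.1) E'.
  by have := h23.2; rewrite -E' -E /det2 /=; have := h12.2; rewrite -E /det2 /=; lia.
have := smooth_le0 h01 Vu n1 n2; have := smooth_le0 h23 Vu n3 n4.
have := hu.2; have D := bezout_diag PV Vu.
rewrite E2 E3 /det2 /= => d1 l1 l2.
have qr : q + r <= -1.
  by rewrite leNgt; apply/negP => ?; have /D : q + r = 0; lia.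
have q0 : q != 0.
  apply/eqP => q0; move: bx => [s [t /= st]].
  by case: (@mulz_neq1 (- t) (- r)); [lia | rewrite -[RHS]st q0; ring].
by lia.
Qed.

Lemma type3P V v0 v1 v2 v3 u : polygon V -> smooth_edge V v0 v1 -> smooth_edge V v1 v2 ->
  smooth_edge V v2 v3 -> singular_edge V v3 u -> singular_edge V u v0 -> u != v0 ->
  is_type3 V.
Proof.
move=> PV h01 h12 h23 h3 hu n0.
have [t|t] := run3_turn PV h01 h12 h23 h3 n0.
  have [a [b [c [d [W [e VW PW E0 E1]]]]]] := std_coord PV h01.2.
  have {}t : det2 (act a b c d v1) (act a b c d v3) = 1 by rewrite det2_act e t.
  move: t; have := smooth_act e VW h01; have := smooth_act e VW h12.
  have := smooth_act e VW h23; have := singular_act e VW h3.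
  have := singular_act e VW hu; rewrite E0 E1 => {}hu {}h3 {}h23 {}h12 {}h01 t.
  have [p [q [r [p0 qr g Ez2 [Ez3 Eu]]]]] := type3_std PW h01 h12 h23 t h3 hu.
  exists p, q, r; split=> //; apply: (equivZ_chain (or_introl e) VW PW).
  by rewrite Ez2 Ez3 Eu; case: h01 h12 h23 h3 hu => [? _] [? _] [? _] [? _] [? _].
have [a [b [c [d [W [e VW PW E0 E1]]]]]] := std_coordN PV h23.2.
have {}t : det2 (act a b c d v2) (act a b c d v0) = 1.
  by rewrite det2_act e; move: t; rewrite /det2; lia.
move: t; have := smooth_actN e VW h01; have := smooth_actN e VW h12.
have := smooth_actN e VW h23; have := singular_actN e VW h3.
have := singular_actN e VW hu; rewrite E0 E1 => {}hu {}h3 {}h23 {}h12 {}h01 t.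
have [p [q [r [p0 qr g Ez2 [Ez3 Eu]]]]] := type3_std PW h23 h12 h01 t hu h3.
exists p, q, r; split=> //; apply: (equivZ_chain (or_intror e) VW PW).
by rewrite Ez2 Ez3 Eu; case: h01 h12 h23 h3 hu => [? _] [? _] [? _] [? _] [? _].
Qed.

(** Stating the permutation through counts lets [lia] verify it for explicit lists. *)
Lemma uniq_perm_cat (T : eqType) (s t r : seq T) :
  uniq s -> (forall P : pred T, count P (t ++ r) = count P s) -> uniq t.
Proof.
move=> Us /permP/perm_uniq; rewrite Us cat_uniq.
by move=> /esym/esym; case: (uniq t).
Qed.

Lemma two_singular_type V : polygon V -> two_singular V ->
  [\/ is_type1 V, is_type2 V | is_type3 V].
Proof.
move=> PV [u1 [v1 [u2 [v2 [h1 h2 n12 all12]]]]].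
have nu := singular_succ_neq h1 h2 n12.
have sm x y : edge V x y -> x != u1 -> x != u2 -> det2 x y = 1.
  move=> xy x1 x2; apply/eqP; have [_ _ d _] := xy.
  have [//|d1] := eqVneq (det2 x y) 1.
  have /all12[[E _]|[E _]] : singular_edge V x y by split=> //; lia.
    by rewrite E eqxx in x1.
  by rewrite E eqxx in x2.
have [s [s3 sp ls]] := singular_run PV h1 (edge_src h2.1) nu sm.
have nu' : u2 != u1 by rewrite eq_sym.
have sm' x y : edge V x y -> x != u2 -> x != u1 -> det2 x y = 1.
  by move=> xy x2 x1; apply: sm xy x1 x2.
have [t [t3 tp lt]] := singular_run PV h2 (edge_src h1.1) nu' sm'.
move: {n12 all12 sm sm'} nu nu'.
wlog st : u1 v1 u2 v2 s t h1 h2 s3 sp ls t3 tp lt / (size t <= size s)%N.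
  move=> H nu nu'; have [st|/ltnW st] := leqP (size t) (size s).
    exact: (H u1 v1 u2 v2 s t).
  exact: (H u2 v2 u1 v1 t s).
move=> nu _.
have U : uniq ((v1 :: s) ++ (v2 :: t)).
  apply: smooth_path_disjoint sp tp _ _ _; rewrite ?ls ?lt.
  - exact: h2.
  - exact: h1.
  - by rewrite eq_sym.
subst u1 u2.
(* One case for each pair of arc lengths, the second at most the first. With no smooth cone at all,
   the two singular edges would be opposite to each other, with determinants of opposite signs. *)
case: s t s3 t3 st sp tp h1 h2 U nu =>
  [|x1 [|x2 [|x3 [|//]]]] [|y1 [|y2 [|y3 [|//]]]] //= _ _ _.
- by move=> _ _ h1 h2 _ _; exfalso; have := h1.2; have := h2.2; rewrite /det2; lia.
- by move=> [h01 _] _ h1 h2 _ _; constructor 1; apply: (type1P PV h01 h2 h1).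
- move=> [h01 _] [k01 _] h1 h2 _ _; exfalso.
  exact: (smooth_square h01 k01 h2.2 h1.2).
- by move=> [h01 [h12 _]] _ h1 h2 _ _; constructor 2; apply: (type2P PV h01 h12 h2 h1).
- move=> [h01 [h12 _]] [k01 _] h1 h2 U _; exfalso.
  exact: (run21 PV U h01 h12 h2 k01 h1).
- move=> [h01 [h12 _]] [k01 [k12 _]] h1 h2 U _; exfalso.
  exact: (run22 PV U h01 h12 h2 k01 k12 h1).
- move=> [h01 [h12 [h23 _]]] _ h1 h2 U _; constructor 3.
  by apply: (type3P PV h01 h12 h23 h2 h1); neq_of U.
- move=> [h01 [h12 [h23 _]]] [k01 _] h1 h2 U _; exfalso.
  apply: (run31 PV U _ h01 h12 h23 h2 k01 k01 h1).
  apply: (@uniq_perm_cat _ [:: v1; x1; x2; x3; v2; y1] _ [::] U).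
  by clear=> P /=; lia.
- move=> [h01 [h12 [h23 _]]] [k01 [k12 _]] h1 h2 U _; exfalso.
  apply: (run31 PV _ _ h01 h12 h23 h2 k01 k12 h1).
    apply: (@uniq_perm_cat _ [:: v1; x1; x2; x3; v2; y1; y2] _ [:: y2] U).
    by clear=> P /=; lia.
  apply: (@uniq_perm_cat _ [:: v1; x1; x2; x3; v2; y1; y2] _ [:: v2] U).
  by clear=> P /=; lia.
- move=> [h01 [h12 [h23 _]]] [k01 [k12 [k23 _]]] h1 h2 U _; exfalso.
  apply: (run31 PV _ _ h01 h12 h23 h2 k01 k23 h1).
    apply: (@uniq_perm_cat _ [:: v1; x1; x2; x3; v2; y1; y2; y3] _ [:: y2; y3] U).
    by clear=> P /=; lia.
  apply: (@uniq_perm_cat _ [:: v1; x1; x2; x3; v2; y1; y2; y3] _ [:: v2; y1] U).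
  by clear=> P /=; lia.
Qed.

Lemma two_singular_equiv V W : equivZ V W -> two_singular W -> two_singular V.
Proof.
move=> [a [b [c [d [e VW]]]]] [u1 [v1 [u2 [v2 [h1 h2 n12 all12]]]]].
have [f ff E] : exists2 f, f * f = 1 & a * d - b * c = f.
  by case: e => ->; [exists 1 | exists (-1)].
have WV := equiv_act_inv E ff VW.
have K z := act_invr z E ff.
have e' : f * d * (f * a) - - (f * b) * - (f * c) = f.
  by transitivity (f * f * (a * d - b * c)); [ring|rewrite ff E mul1r].
move: WV K e'; set a' := f * d; set b' := - (f * b); set c' := - (f * c); set d' := f * a.
move=> WV K e'; have inj : injective (act a' b' c' d').
  by apply: act_inj; rewrite e' -E.
have fE : f = 1 \/ f = -1 by rewrite -E.
have n12' : forall x y x' y' : vec, (x, y) != (x', y') ->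
    (act a' b' c' d' x, act a' b' c' d' y) != (act a' b' c' d' x', act a' b' c' d' y').
  move=> x y x' y'; apply: contraNneq => xy.
  by rewrite (inj _ _ (congr1 fst xy)) (inj _ _ (congr1 snd xy)).
case: fE => f1; rewrite f1 in e' E.
  exists (act a' b' c' d' u1), (act a' b' c' d' v1),
    (act a' b' c' d' u2), (act a' b' c' d' v2).
  split; [exact: singular_act h1|exact: singular_act h2|exact: n12'|].
  move=> u v uv; have := singular_act E VW uv => /all12[[Eu Ev]|[Eu Ev]].
    by left; rewrite -Eu -Ev !K.
  by right; rewrite -Eu -Ev !K.
exists (act a' b' c' d' v1), (act a' b' c' d' u1),
  (act a' b' c' d' v2), (act a' b' c' d' u2).
split; [exact: singular_actN h1|exact: singular_actN h2| |].
  by apply: n12'; apply: contra_neq n12 => -[-> ->].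
move=> u v uv; have := singular_actN E VW uv => /all12[[Eu Ev]|[Eu Ev]].
  by left; rewrite -Eu -Ev !K.
by right; rewrite -Eu -Ev !K.
Qed.

(** * Edges of the model polygons *)

Lemma mem_edge (s : seq vec) u v : u \in s -> v \in s -> 0 < det2 u v ->
  all (fun z => [|| z == u, z == v | det2 u z + det2 z v < det2 u v]) s ->
  edge (fun z => z \in s) u v.
Proof.
move=> us vs uv0 /allP H; split=> // z /H /or3P[/eqP->|/eqP->|//]; rewrite ?eqxx //.
Qed.

Ltac mem_edge_tac S :=
  apply: (mem_edge (s := S)); rewrite ?inE ?eqxx ?orbT ?andbT /det2 //=;
  repeat (apply/andP; split); rewrite // ?eqxx ?orbT //;
  first [by apply/or3P; constructor 3; lia | lia].

Lemma triangle_chain p q : 0 < p -> 0 < q ->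
  chain (fun z => z \in triangle p q) (1, 0) [:: (0, 1); (- p, - q)] (1, 0).
Proof.
move=> p0 q0; do 2 (split; first by mem_edge_tac (triangle p q)).
by mem_edge_tac (triangle p q).
Qed.

Lemma quadrilateral_chain p q r : p <= 1 ->
  r <= Num.min (Num.min (- (p * q) - 2) (- 2)) (Num.min (- q - 1) (q - p * q - 1)) ->
  gcdz q r = 1 ->
  chain (fun z => z \in quadrilateral p q r) (1, 0) [:: (0, 1); (-1, p); (q, r)] (1, 0).
Proof.
move=> p1 rmin g.
have [r1 r2 r3 r4] : [/\ r <= - (p * q) - 2, r <= -2, r <= - q - 1 & r <= q - p * q - 1].
  by move: rmin; rewrite !le_min => /andP[/andP[-> ->] /andP[-> ->]].
have q0 : q != 0.
  by apply/eqP => q0; move: g; rewrite q0 gcd0z; lia.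
(* Strict convexity at (q, r): this is the inequality for (1, 0) and the edge from (-1, p), and also
   for (-1, p) and the edge to (1, 0). The remaining edge inequalities follow directly from the
   bounds. *)
have key : r + r + p * q - p < 0.
  have [?|[?|?]] : 1 <= q \/ q = -1 \/ q <= -2 by lia.
  - have [?|?] : p = 1 \/ p <= 0 by lia.
      by subst p; lia.
    by nia.
  - by subst q; lia.
  - have [?|?] : p = 1 \/ p <= 0 by lia.
      by subst p; lia.
    by nia.
clear rmin g; do 3 (split; first by mem_edge_tac (quadrilateral p q r)).
by mem_edge_tac (quadrilateral p q r).
Qed.

Lemma pentagon_chain p q r : p <= 0 -> 1 <= q <= - r - 1 ->
  chain (fun z => z \in pentagon p q r) (1, 0)
    [:: (0, 1); (-1, p + 1); (-1, p); (q, r)] (1, 0).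
Proof.
move=> p0 /andP[q1 qr]; have pq : p * q <= p by nia.
do 4 (split; first by mem_edge_tac (pentagon p q r)).
by mem_edge_tac (pentagon p q r).
Qed.

Lemma chain_succ_pred V u s : chain V u s u -> forall v, v \in u :: s ->
  (exists w, edge V v w) /\ (exists w, edge V w v).
Proof.
suff H w : forall u, chain V u s w ->
    (forall v, v \in u :: s -> exists x, edge V v x) /\
    (forall v, v \in rcons s w -> exists x, edge V x v).
  move=> /H[Hs Hp] v vus; split; first exact: Hs.
  by apply: Hp; rewrite mem_rcons.
elim: s => [|x s IH] {}u /=.
  by move=> uw; split=> v; rewrite mem_seq1 => /eqP ->; [exists w|exists u].
move=> [ux /IH[Hs Hp]]; split=> v; rewrite inE => /predU1P[->|].
- by exists x.
- exact: Hs.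
- by exists u.
- exact: Hp.
Qed.

Lemma type1_singular V : is_type1 V -> two_singular V.
Proof.
move=> [p [q [p2 q2 _ VT]]]; apply: two_singular_equiv VT _.
have [] : 0 < p /\ 0 < q by lia.
move=> /triangle_chain/[apply]; set W := (fun z => _) => -[h01 [h12 h20]].
exists (0, 1), (- p, - q), (- p, - q), (1, 0); split.
- by split=> //; rewrite /det2 /=; lia.
- by split=> //; rewrite /det2 /=; lia.
- by apply/eqP => -[]; lia.
move=> u v [uv d]; have := edge_src uv; rewrite /W !inE => /or3P[]/eqP Eu; subst u.
- by rewrite -(edge_succ_inj h01 uv) in d.
- by left; rewrite (edge_succ_inj uv h12).
- by right; rewrite (edge_succ_inj uv h20).
Qed.

Lemma type2_singular V : is_type2 V -> two_singular V.
Proof.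
move=> [p [q [r [p1 rmin g VT]]]]; apply: two_singular_equiv VT _.
have [r1 r2] : r <= - (p * q) - 2 /\ r <= -2 by lia.
have := quadrilateral_chain p1 rmin g; set W := (fun z => _) => -[h01 [h12 [h23 h30]]].
exists (-1, p), (q, r), (q, r), (1, 0); split.
- by split=> //; rewrite /det2 /=; lia.
- by split=> //; rewrite /det2 /=; lia.
- by apply/eqP => -[]; lia.
move=> u v [uv d]; have := edge_src uv; rewrite /W !inE => /or4P[]/eqP Eu; subst u.
- by rewrite -(edge_succ_inj h01 uv) in d.
- by rewrite -(edge_succ_inj h12 uv) /det2 /= in d; lia.
- by left; rewrite (edge_succ_inj uv h23).
- by right; rewrite (edge_succ_inj uv h30).
Qed.

Lemma type3_singular V : is_type3 V -> two_singular V.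
Proof.
move=> [p [q [r [p0 qr _ VT]]]]; apply: two_singular_equiv VT _.
have := pentagon_chain p0 qr; set W := (fun z => _) => -[h01 [h12 [h23 [h34 h40]]]].
move: qr => /andP[q1 qr]; have pq : p * q <= 0 by nia.
exists (-1, p), (q, r), (q, r), (1, 0); split.
- by split=> //; rewrite /det2 /=; lia.
- by split=> //; rewrite /det2 /=; lia.
- by apply/eqP => -[]; lia.
move=> u v [uv d]; have := edge_src uv.
rewrite /W !inE => /or4P[/eqP Eu|/eqP Eu|/eqP Eu|/orP[]/eqP Eu]; subst u.
- by rewrite -(edge_succ_inj h01 uv) in d.
- by rewrite -(edge_succ_inj h12 uv) /det2 /= in d; lia.
- by rewrite -(edge_succ_inj h23 uv) /det2 /= in d; lia.
- by left; rewrite (edge_succ_inj uv h34).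
- by right; rewrite (edge_succ_inj uv h40).
Qed.

(** * Convex hulls and exposed points *)

(** Convexity with two plain real weights in place of the bundled parameter of [convex_set]. *)
Definition convex_comb (R : realType) (C : set 'cV[R]_2) : Prop :=
  forall x y (a b : R), C x -> C y -> 0 <= a -> 0 <= b -> a + b = 1 ->
    C (a *: x + b *: y).

Lemma convex_setP (R : realType) (C : set 'cV[R]_2) :
  @convex_set R 'cV[R]_2 C <-> convex_comb C.
Proof.
split=> [cC x y a b Cx Cy a0 b0 ab|cC x y k].
  have a1 : a <= 1 by lra.
  have -> : b = 1 - (Itv01 a0 a1)%:num by rewrite /=; lra.
  by apply/set_mem; apply: (cC x y (Itv01 a0 a1)); rewrite inE.
rewrite !inE => Cx Cy; apply: cC => //.
  by change (0 <= 1 - k%:num); rewrite subr_ge0.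
by change (k%:num + (1 - k%:num) = 1); rewrite subrKC.
Qed.

Lemma convex_hull_min (R : realType) (A C : set 'cV[R]_2) :
  convex_comb C -> A `<=` C -> convex_hull A `<=` C.
Proof. by move=> /convex_setP cC AC; apply: smallest_sub. Qed.

Lemma sub_convex_hull (R : realType) (A : set 'cV[R]_2) : A `<=` convex_hull A.
Proof. exact: sub_gen_smallest. Qed.

Lemma convex_hull_convex (R : realType) (A : set 'cV[R]_2) :
  convex_comb (convex_hull A).
Proof.
move=> x y a b hx hy a0 b0 ab C [cC AC].
have /convex_setP cC' := cC.
by apply: cC' => //; [apply: hx|apply: hy].
Qed.

Definition covec (R : realType) (a b : R) : 'rV[R]_2 := \row_j [:: a; b]`_j.

Lemma dotE (R : realType) (l : 'rV[R]_2) x :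
  dot l x = l 0 0 * x 0 0 + l 0 1 * x 1 0.
Proof.
by rewrite /dot mxE big_ord_recl big_ord1; congr (_ + l _ _ * x _ _); apply: val_inj.
Qed.

Lemma dot_covec (R : realType) (a b : R) x : dot (covec a b) x = a * x 0 0 + b * x 1 0.
Proof. by rewrite dotE !mxE. Qed.

Lemma dotD (R : realType) (l : 'rV[R]_2) x y : dot l (x + y) = dot l x + dot l y.
Proof. by rewrite /dot mulmxDr mxE. Qed.

Lemma dotZ (R : realType) (l : 'rV[R]_2) a x : dot l (a *: x) = a * dot l x.
Proof. by rewrite /dot -scalemxAr mxE. Qed.

Lemma dot0 (R : realType) (l : 'rV[R]_2) : dot l 0 = 0.
Proof. by rewrite /dot mulmx0 mxE. Qed.

Lemma dotDl (R : realType) (l m : 'rV[R]_2) x : dot (l + m) x = dot l x + dot m x.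
Proof. by rewrite /dot mulmxDl mxE. Qed.

Lemma dotZl (R : realType) a (l : 'rV[R]_2) x : dot (a *: l) x = a * dot l x.
Proof. by rewrite /dot -scalemxAl mxE. Qed.

Lemma plane_eq (R : realType) (x y : 'cV[R]_2) :
  x 0 0 = y 0 0 -> x 1 0 = y 1 0 -> x = y.
Proof.
move=> e0 e1; apply/matrixP => i j; rewrite ord1.
by case: i => [[|[|//]] Hi]; [move: e0|move: e1] => e;
  congr (_ = _) : e; congr (_ _ _); apply: val_inj.
Qed.

Lemma covec_neq0 (R : realType) (l : 'rV[R]_2) : l != 0 -> l 0 0 != 0 \/ l 0 1 != 0.
Proof.
move=> l0; have [E0|] := eqVneq (l 0 0) 0; last by left.
have [E1|] := eqVneq (l 0 1) 0; last by right.
case/eqP: l0; apply/matrixP => i j; rewrite ord1 mxE.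
by case: j => [[|[|//]] Hj]; [rewrite -[RHS]E0|rewrite -[RHS]E1];
  congr (l _ _); apply: val_inj.
Qed.

Lemma dot_hull_le (R : realType) (A : set 'cV[R]_2) l (c : R) :
  (forall x, A x -> dot l x <= c) -> forall x, convex_hull A x -> dot l x <= c.
Proof.
move=> Ac; apply: convex_hull_min => // x y a b /= xc yc a0 b0 ab.
rewrite dotD !dotZ -[leRHS]mul1r -ab mulrDl.
by rewrite lerD// ler_wpM2l.
Qed.

(** The points with [dot l x < c], together with those of [C] on the line [dot l x = c], form a
    convex set containing [A]. *)
Lemma hull_face (R : realType) (A C : set 'cV[R]_2) l (c : R) : convex_comb C ->
  (forall x, A x -> dot l x < c \/ (dot l x = c /\ C x)) ->
  forall x, convex_hull A x -> dot l x = c -> C x.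
Proof.
move=> cC AC; suff H : convex_hull A `<=` [set x | dot l x < c \/ (dot l x = c /\ C x)].
  by move=> x /H[lx|[]//] E; rewrite E ltxx in lx.
apply: convex_hull_min => // x y a b hx hy a0 b0 ab.
have [a_0|an0] := eqVneq a 0.
  have b1 : b = 1 by lra.
  by rewrite a_0 b1 scale0r scale1r add0r.
have [b_0|bn0] := eqVneq b 0.
  have a1 : a = 1 by lra.
  by rewrite b_0 a1 scale0r scale1r addr0.
have ap : 0 < a by rewrite lt_neqAle eq_sym an0.
have bp : 0 < b by rewrite lt_neqAle eq_sym bn0.
have cE : c = a * c + b * c by rewrite -mulrDl ab mul1r.
rewrite /= dotD !dotZ [X in _ < X \/ _]cE [X in _ \/ (_ = X /\ _)]cE.
move: hx hy => /= [hx|[hx Cx]] [hy|[hy Cy]].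
- by left; rewrite ltrD // ltr_pM2l.
- by left; rewrite hy ltrD2r ltr_pM2l.
- by left; rewrite hx ltrD2l ltr_pM2l.
- by right; rewrite hx hy; split=> //; apply: cC.
Qed.

Lemma dot_hull_lt (R : realType) (A : set 'cV[R]_2) l v :
  (forall x, A x -> x <> v -> dot l x < dot l v) ->
  forall x, convex_hull A x -> x <> v -> dot l x < dot l v.
Proof.
move=> Ac x hx xv; rewrite lt_neqAle; apply/andP; split.
  apply/eqP; apply: contra_not xv.
  apply: (@hull_face _ A [set v]) hx => [y z a b -> ->|y Ay].
    by move=> _ _ ab /=; rewrite -scalerDl ab scale1r.
  by have [->|yv] := pselect (y = v); [right|left; apply: Ac].
apply: dot_hull_le hx => y Ay; have [->//|yv] := pselect (y = v).
by apply/ltW/Ac.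
Qed.

Lemma vertices_exposed (R : realType) (Q : set 'cV[R]_2) x : vertices Q x ->
  exists l, [/\ l != 0, Q x & forall y, Q y -> y <> x -> dot l y < dot l x].
Proof.
move=> [l [c [l0 Qc E]]]; exists l.
have [Qx lx] : (Q `&` [set y | dot l y = c]) x by rewrite -E.
split=> // y Qy yx; rewrite lx lt_neqAle Qc// andbT; apply/eqP => ly.
by apply: yx; have : (Q `&` [set y | dot l y = c]) y by []; rewrite -E.
Qed.

Lemma exposed_vertices (R : realType) (Q : set 'cV[R]_2) x l : l != 0 -> Q x ->
  (forall y, Q y -> y <> x -> dot l y < dot l x) -> vertices Q x.
Proof.
move=> l0 Qx Qlt; exists l, (dot l x); split=> // [y Qy|].
  by have [->|/(Qlt _ Qy)/ltW] := pselect (y = x).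
apply/seteqP; split=> [y /= ->//|y [Qy /= ly]].
by have [//|/(Qlt _ Qy)] := pselect (y = x); rewrite ly ltxx.
Qed.

Lemma lex_max (T : eqType) (R : realType) (x0 : T) (s : seq T) (f g : T -> R) :
  exists2 v, v \in x0 :: s & forall a, a \in x0 :: s ->
    f a < f v \/ (f a = f v /\ g a <= g v).
Proof.
elim: s => [|y s [v vs vP]].
  by exists x0 => [|a]; rewrite ?mem_head // mem_seq1 => /eqP ->; right.
have memP a : a \in [:: x0, y & s] -> a = y \/ a \in x0 :: s.
  by rewrite !inE => /or3P[->|/eqP->|->]; rewrite ?orbT; [right|left|right].
have [yv|vy|yv] := ltgtP (f y) (f v).
- exists v => [|a /memP[->|/vP//]]; last by left.
  by move: vs; rewrite !inE => /orP[]->; rewrite ?orbT.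
- exists y => [|a /memP[->|/vP[h|[-> _]]]]; first by rewrite !inE eqxx orbT.
  + by right.
  + by left; apply: lt_trans vy.
  + by left.
have [gle|glt] := leP (g y) (g v).
  exists v => [|a /memP[->|/vP//]]; last by right.
  by move: vs; rewrite !inE => /orP[]->; rewrite ?orbT.
exists y => [|a /memP[->|/vP[h|[h h']]]]; first by rewrite !inE eqxx orbT.
- by right.
- by left; rewrite yv.
- by right; rewrite yv; split=> //; apply: le_trans h' (ltW glt).
Qed.

(** On finitely many points, lexicographic positivity of (f, g) becomes positivity of [f + d * g]
    for every small [d > 0]. *)
Lemma lex_perturb (T : eqType) (R : realType) (s : seq T) (f g : T -> R) :
  (forall a, a \in s -> 0 < f a \/ (f a = 0 /\ 0 < g a)) ->
  exists2 e, 0 < e & forall d, 0 < d <= e -> forall a, a \in s -> 0 < f a + d * g a.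
Proof.
elim: s => [_|x s IH H]; first by exists 1.
have [|e e0 eP] := IH; first by move=> a sa; apply: H; rewrite inE sa orbT.
have [fx|[fx gx]] := H x (mem_head _ _); last first.
  exists e => // d /andP[d0 de] a; rewrite inE => /predU1P[->|sa].
    by rewrite fx add0r mulr_gt0.
  by apply: eP => //; rewrite d0.
have g0 : 0 < `|g x| + 1 by rewrite ltr_wpDl.
exists (Num.min e (f x / (`|g x| + 1))); first by rewrite lt_min e0 divr_gt0.
move=> d /andP[d0]; rewrite le_min => /andP[de dx] a.
rewrite inE => /predU1P[->|sa]; last first.
  by apply: eP => //; rewrite d0.
have : d * (`|g x| + 1) <= f x by rewrite -ler_pdivlMr.
have : - (d * `|g x|) <= d * g x.
  by rewrite -mulrN ler_pM2l// lerNl -normrN ler_norm.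
by lra.
Qed.

Lemma dot_tr_gt0 (R : realType) (l : 'rV[R]_2) : l != 0 -> 0 < l 0 0 ^+ 2 + l 0 1 ^+ 2.
Proof.
by case/covec_neq0 => h; [apply: ltr_pwDl|apply: ltr_pwDr];
  rewrite ?exprn_even_gt0 ?sqr_ge0.
Qed.

Lemma exists_vertex_max (R : realType) (A : set 'cV[R]_2) (l : 'rV[R]_2) :
  finite_set A -> A !=set0 -> l != 0 ->
  exists2 v, vertices (convex_hull A) v &
    forall x, convex_hull A x -> dot l x <= dot l v.
Proof.
move=> /finite_seqP[s sA] [x0 Ax0] l0.
have x0s : x0 \in s by rewrite sA in Ax0.
have Ain x : A x <-> x \in x0 :: s.
  by rewrite sA inE /=; split=> [->|/predU1P[->|]//]; rewrite ?orbT.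
(* A quarter turn of [l]: together [l] and [m] separate points, so the lexicographic maximum is
   unique and a small perturbation of [l] by [m] exposes it. *)
pose m := covec (- l 0 1) (l 0 0).
have [v /Ain Av vP] := lex_max x0 s (dot l) (dot m).
have vmax x : convex_hull A x -> dot l x <= dot l v.
  by apply: dot_hull_le => a /Ain/vP[/ltW//|[->]].
exists v => //.
have inj x : dot l x = dot l v -> dot m x = dot m v -> x = v.
  rewrite !dot_covec !dotE => e1 e2.
  have ll := dot_tr_gt0 l0.
  apply: plane_eq; apply: (mulfI (lt0r_neq0 ll)).
    transitivity (l 0 0 * (l 0 0 * x 0 0 + l 0 1 * x 1 0) -
                  l 0 1 * (- l 0 1 * x 0 0 + l 0 0 * x 1 0)); first by ring.
    by rewrite e1 e2; ring.
  transitivity (l 0 1 * (l 0 0 * x 0 0 + l 0 1 * x 1 0) +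
                l 0 0 * (- l 0 1 * x 0 0 + l 0 0 * x 1 0)); first by ring.
  by rewrite e1 e2; ring.
pose t := [seq x <- x0 :: s | x != v].
have [] := @lex_perturb _ R t (fun x => dot l v - dot l x) (fun x => dot m v - dot m x).
  move=> a; rewrite mem_filter => /andP[/eqP av /vP[h|[h h']]].
    by left; rewrite subr_gt0.
  right; rewrite h subrr; split=> //; rewrite subr_gt0 lt_neqAle h' andbT.
  by apply/eqP => /(inj _ h).
move=> e e0 /(_ e); rewrite e0 lexx => /(_ isT) eP.
have lt a : A a -> a <> v -> dot (l + e *: m) a < dot (l + e *: m) v.
  move=> /Ain As av; have /eP : a \in t by rewrite mem_filter As andbT; apply/eqP.
  by rewrite !dotDl !dotZl; lra.
apply: (@exposed_vertices _ _ _ (l + e *: m)).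
(* The perturbed form is nonzero because its value at the transpose of [l] is the squared length of
   [l]. *)
- apply/eqP => E; have : dot (l + e *: m) l^T = 0 by rewrite E /dot mul0mx mxE.
  rewrite dotDl dotZl dot_covec dotE !mxE [l 0 0 * l 0 1]mulrC mulNr addNr mulr0 addr0.
  by apply/eqP; rewrite -!expr2 gt_eqF ?dot_tr_gt0.
- exact: sub_convex_hull.
- exact: dot_hull_lt.
Qed.

Lemma convex_comb_lt (R : realType) (a b x y c : R) :
  0 <= a -> 0 <= b -> a + b = 1 -> x < c -> y < c -> a * x + b * y < c.
Proof.
move=> a0 b0 ab xc yc; have [a_0|an0] := eqVneq a 0.
  by have b1 : b = 1 by [lra]; rewrite a_0 b1; lra.
have ac : 0 < a * (c - x) by rewrite mulr_gt0 ?subr_gt0 // lt_neqAle eq_sym an0.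
have bc : 0 <= b * (c - y) by rewrite mulr_ge0 ?subr_ge0 // ltW.
have -> : c = a * c + b * c by rewrite -mulrDl ab mul1r.
by lra.
Qed.

(** If [v] were not in [A], the form exposing [v] would be less than its value at [v] on all of [A],
    hence on the hull, which contains [v]. *)
Lemma vertices_hull_sub (R : realType) (A : set 'cV[R]_2) :
  vertices (convex_hull A) `<=` A.
Proof.
move=> v /vertices_exposed[l [_ hv lt]]; apply: contrapT => nAv.
have : convex_hull A `<=` [set x | dot l x < dot l v].
  apply: convex_hull_min => [x y a b /= hx hy a0 b0 ab|a Aa /=].
    by rewrite dotD !dotZ; apply: convex_comb_lt.
  by apply: lt; [exact: sub_convex_hull|move=> E; apply: nAv; rewrite -E].
by move=> /(_ v hv) /=; rewrite ltxx.
Qed.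

Lemma interior_dot_pos (R : realType) (Q : set 'cV[R]_2) (l : 'rV[R]_2) :
  Q° 0 -> l != 0 -> exists2 x, Q x & 0 < dot l x.
Proof.
move=> Q0 l0.
have : nbhs (0 *: l^T : 'cV[R]_2) Q by rewrite scale0r.
move=> /(@scalel_continuous _ _ l^T 0)/nbhs_ballP[e /= e0 eQ].
exists ((e / 2) *: l^T).
  by apply: eQ; rewrite /ball /= sub0r normrN gtr0_norm ?divr_gt0//; lra.
by rewrite dotZ mulr_gt0 ?divr_gt0// dotE !mxE -!expr2 dot_tr_gt0.
Qed.

(** * LDP-polygons *)

Definition ptv (R : realType) (z : vec) : 'cV[R]_2 := pt R z.1 z.2.

Lemma ptv0 (R : realType) z : ptv R z 0 0 = z.1%:~R.
Proof. by rewrite !mxE. Qed.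

Lemma ptv1 (R : realType) z : ptv R z 1 0 = z.2%:~R.
Proof. by rewrite !mxE. Qed.

Lemma ptv_inj (R : realType) : injective (@ptv R).
Proof.
by move=> u v E; apply: vec_eq; apply: (@intr_inj R); rewrite -?ptv0 -?ptv1 E.
Qed.

Lemma real_vec_ptv (R : realType) (v : 'cV[int]_2) :
  real_vec R v = ptv R (v 0 0, v 1 0).
Proof. by apply: plane_eq; rewrite ?ptv0 ?ptv1 !mxE. Qed.

Lemma dot_ptv_plucker (R : realType) (l : 'rV[R]_2) u v z :
  (det2 u v)%:~R * dot l (ptv R z) =
  (det2 z v)%:~R * dot l (ptv R u) + (det2 u z)%:~R * dot l (ptv R v).
Proof. by rewrite !dotE !ptv0 !ptv1 /det2 !intrD !intrN !intrM; ring. Qed.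

Definition vertex_set (R : realType) (Q : set 'cV[R]_2) (z : vec) : Prop :=
  vertices Q (ptv R z).

Lemma vertices_ptv (R : realType) (Q : set 'cV[R]_2) x : LDP_polygon Q ->
  vertices Q x -> exists2 z, vertex_set Q z & x = ptv R z.
Proof.
move=> [[_ lat] _ _] Qx; have [v E] := lat _ Qx.
by exists (v 0 0, v 1 0); rewrite -?real_vec_ptv // /vertex_set -real_vec_ptv -E.
Qed.

Lemma vertex_bezout (R : realType) (Q : set 'cV[R]_2) z : LDP_polygon Q ->
  vertex_set Q z -> bezout z.
Proof.
move=> [_ _ prim] /prim; rewrite /primitive !mxE /= => g.
by apply/gcdz_bezout.
Qed.

Lemma vertex_max (R : realType) (Q : set 'cV[R]_2) l : LDP_polygon Q -> l != 0 ->
  exists z, [/\ vertex_set Q z, forall x, Q x -> dot l x <= dot l (ptv R z) &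
    0 < dot l (ptv R z)].
Proof.
move=> hQ l0; have [[[A Afin QA] _] Q0 _] := hQ.
have [x Qx lx] := interior_dot_pos Q0 l0.
have An0 : A !=set0.
  apply: contrapT => nA; move: Qx; rewrite QA => hx.
  by apply: (@convex_hull_min R A set0 _ _ x hx) => // a Aa; apply: nA; exists a.
have [v Qv vmax] := exists_vertex_max Afin An0 l0.
rewrite -QA in Qv vmax; have [z Vz E] := vertices_ptv hQ Qv.
exists z; rewrite -E; split=> //.
by apply: lt_le_trans lx _; apply: vmax.
Qed.

Lemma LDP_zero (R : realType) (Q : set 'cV[R]_2) : LDP_polygon Q -> Q 0.
Proof. by move=> [_ Q0 _]; apply: interior_subset. Qed.

Lemma ptv_neq0 (R : realType) z : bezout z -> ptv R z <> 0.
Proof.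
move=> /bezout_neq0/eqP bz E; apply: bz; apply: vec_eq; apply: (@intr_inj R) => /=.
  by rewrite -ptv0 E mxE.
by rewrite -ptv1 E mxE.
Qed.

Lemma LDP_convex (R : realType) (Q : set 'cV[R]_2) : LDP_polygon Q -> convex_comb Q.
Proof. by move=> [[[A _ ->] _] _ _]; apply: convex_hull_convex. Qed.

Lemma vertex_exposed (R : realType) (Q : set 'cV[R]_2) z : LDP_polygon Q ->
  vertex_set Q z -> exists l, [/\ 0 < dot l (ptv R z), Q (ptv R z) &
    forall y, Q y -> y <> ptv R z -> dot l y < dot l (ptv R z)].
Proof.
move=> hQ Vz; have [l [l0 Qz lt]] := vertices_exposed Vz; exists l; split=> //.
rewrite -(dot0 l); apply: lt; first exact: LDP_zero.
by apply/nesym/ptv_neq0; apply: vertex_bezout hQ Vz.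
Qed.

Lemma vertex_exposed_vertex (R : realType) (Q : set 'cV[R]_2) z : LDP_polygon Q ->
  vertex_set Q z -> exists l, 0 < dot l (ptv R z) /\
    forall y, vertex_set Q y -> y != z -> dot l (ptv R y) < dot l (ptv R z).
Proof.
move=> hQ Vz; have [l [l0 Qz lt]] := vertex_exposed hQ Vz; exists l; split=> //.
move=> y Vy yz; apply: lt; first by have [m []] := vertex_exposed hQ Vy.
by move=> /ptv_inj E; rewrite E eqxx in yz.
Qed.

Lemma vertex_finite (R : realType) (Q : set 'cV[R]_2) : LDP_polygon Q ->
  exists s : seq vec, forall z, vertex_set Q z <-> z \in s.
Proof.
move=> hQ; have /finite_seqP[t tE] := finite_vertices hQ.
exists [seq (Num.floor (x 0 0), Num.floor (x 1 0)) | x : 'cV[R]_2 <- t] => z.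
have fz : (Num.floor (ptv R z 0 0), Num.floor (ptv R z 1 0)) = z.
  by rewrite ptv0 ptv1 !intrKfloor; case: z.
have memt x : vertices Q x <-> x \in t by rewrite tE.
split=> [/memt Vz|/mapP[x /memt Qx ->]]; first by apply/mapP; exists (ptv R z).
by have [y Vy ->] := vertices_ptv hQ Qx; rewrite ptv0 ptv1 !intrKfloor -surjective_pairing.
Qed.

(** Totality and transitivity are asked on [s] only, since the sign of [det2] orders directions
    within a half-plane but not globally. *)
Lemma exists_least (T : eqType) (r : rel T) (s : seq T) : s != [::] ->
  {in s &, total r} -> {in s & &, transitive r} ->
  exists2 w, w \in s & {in s, forall z, r w z}.
Proof.
elim: s => // x s IH _ tot tr.
have sub : {subset s <= x :: s} by move=> y ys; rewrite inE ys orbT.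
have rxx : r x x by have := tot x x (mem_head _ _) (mem_head _ _); rewrite orbb.
have [s0|sn0] := eqVneq s [::].
  by exists x => [|z]; rewrite s0 ?mem_head // mem_seq1 => /eqP ->.
have [||w ws wP] := IH sn0.
- by move=> y z ys zs; apply: tot; apply: sub.
- by move=> y z t ys zs ts; apply: tr; apply: sub.
have /orP[wx|xw] := tot w x (sub _ ws) (mem_head _ _).
  exists w; first exact: sub.
  by move=> z; rewrite inE => /predU1P[->|/wP].
exists x; first exact: mem_head.
move=> z; rewrite inE => /predU1P[->//|zs].
by apply: (tr w) => //; [exact: sub | exact: mem_head | exact: sub | exact: wP].
Qed.

(* On an open half-plane the sign of det2 is a total order on directions. *)
Lemma half_plane_order (R : realType) (l : 'rV[R]_2) u v w :
  0 < dot l (ptv R u) -> 0 < dot l (ptv R v) -> 0 < dot l (ptv R w) ->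
  0 <= det2 u v -> 0 <= det2 v w -> 0 <= det2 u w.
Proof.
move=> u0 v0 w0 uv vw; rewrite -(ler0z R).
rewrite -(pmulr_lge0 _ v0) dot_ptv_plucker.
have D x y : det2 x y = - det2 y x by rewrite /det2; ring.
by rewrite addr_ge0 // mulr_ge0 ?ler0z // ltW.
Qed.

Lemma exists_extreme (R : realType) (l : 'rV[R]_2) (s : seq vec) z : z \in s ->
  0 < dot l (ptv R z) ->
  (exists w, [/\ w \in s, 0 < dot l (ptv R w) &
     forall z, z \in s -> 0 < dot l (ptv R z) -> 0 <= det2 w z]) /\
  (exists w, [/\ w \in s, 0 < dot l (ptv R w) &
     forall z, z \in s -> 0 < dot l (ptv R z) -> 0 <= det2 z w]).
Proof.
move=> zs z0; pose t := [seq x <- s | 0 < dot l (ptv R x)].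
have memt x : (x \in t) = (0 < dot l (ptv R x)) && (x \in s) by rewrite mem_filter.
have t0 : t != [::].
  by apply/eqP => t0; have := memt z; rewrite t0 z0 zs.
split.
  have [||w] := @exists_least _ (fun x y => 0 <= det2 x y) t t0.
  - by move=> x y _ _; rewrite /det2; lia.
  - move=> y x w; rewrite !memt => /andP[y0 _] /andP[x0 _] /andP[w0 _].
    exact: (half_plane_order x0 y0 w0).
  rewrite memt => /andP[w0 ws] wP; exists w; split=> // x xs x0.
  by apply: wP; rewrite memt x0.
have [||w] := @exists_least _ (fun x y => 0 <= det2 y x) t t0.
- by move=> x y _ _; rewrite /det2; lia.
- move=> y x w; rewrite !memt => /andP[y0 _] /andP[x0 _] /andP[w0 _] xy yw.
  exact: (half_plane_order w0 y0 x0).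
rewrite memt => /andP[w0 ws] wP; exists w; split=> // x xs x0.
by apply: wP; rewrite memt x0.
Qed.

(** To be read with D z = x v + y w, where [a], [b], [c] are the values at v, w, z of a form
    exposing v. *)
Lemma exposed_arith (R : realType) (D x y a b c : R) : 0 < D -> y <= 0 ->
  D <= x + y -> 0 < a -> b < a -> c < a -> D * c = x * a + y * b -> False.
Proof.
move=> D0 y0 Dxy a0 ba ca E.
have : D * c < D * a by rewrite ltr_pM2l.
have : y * a <= y * b by rewrite ler_wnM2l// ltW.
have : D * a <= (x + y) * a by rewrite ler_pM2r.
by lra.
Qed.

(** A vertex [z] on or beyond the line through [v] and [w] but outside the open cone has a
    nonpositive coefficient at one of them. A form exposing the other vertex would then be at least
    as large at [z]. *)
Lemma empty_cone_edge (R : realType) (Q : set 'cV[R]_2) v w : LDP_polygon Q ->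
  vertex_set Q v -> vertex_set Q w -> 0 < det2 v w ->
  (forall z, vertex_set Q z -> 0 < det2 v z -> 0 < det2 z w -> False) ->
  edge (vertex_set Q) v w.
Proof.
move=> hQ Vv Vw d0 empty; split=> // z Vz zv zw.
have vw : w != v.
  by apply/eqP => E; move: d0; rewrite E /det2; lia.
rewrite ltNge; apply/negP => le_d.
have D0 : 0 < (det2 v w)%:~R :> R by rewrite ltr0z.
have leR : (det2 v w)%:~R <= (det2 z w)%:~R + (det2 v z)%:~R :> R.
  by rewrite -intrD ler_int addrC.
have [y0|y0] := leP (det2 v z) 0.
  have [l [l0 lt]] := vertex_exposed_vertex hQ Vv.
  have y0' : (det2 v z)%:~R <= 0 :> R by rewrite lerz0.
  exact: (exposed_arith D0 y0' leR l0 (lt _ Vw vw) (lt _ Vz zv) (dot_ptv_plucker l v w z)).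
have [x0|x0] := leP (det2 z w) 0; last exact: (empty z).
have [l [l0 lt]] := vertex_exposed_vertex hQ Vw.
have x0' : (det2 z w)%:~R <= 0 :> R by rewrite lerz0.
rewrite addrC in leR; rewrite eq_sym in vw.
apply: (exposed_arith D0 x0' leR l0 (lt _ Vv vw) (lt _ Vz zw)).
by rewrite dot_ptv_plucker addrC.
Qed.

Lemma dot_covec_ptv (R : realType) (v z : vec) :
  dot (covec (- v.2%:~R) v.1%:~R : 'rV[R]_2) (ptv R z) = (det2 v z)%:~R.
Proof. by rewrite dot_covec ptv0 ptv1 /det2 intrD intrN !intrM; ring. Qed.

Lemma covec_eq0 (R : realType) (a b : R) : covec a b = 0 -> a = 0 /\ b = 0.
Proof.
move=> E; have e i : covec a b 0 i = 0 by rewrite E mxE.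
by have := e 0; have := e 1; rewrite !mxE.
Qed.

Lemma covec_ptv_neq0 (R : realType) (v : vec) : bezout v ->
  covec (- v.2%:~R) v.1%:~R != 0 :> 'rV[R]_2.
Proof.
move=> /bezout_neq0; apply: contraNneq => /covec_eq0[/eqP + /eqP].
by rewrite oppr_eq0 !intr_eq0 => /eqP v2 /eqP v1; rewrite (surjective_pairing v) v1 v2.
Qed.

(** Since the origin is interior, some vertex lies strictly to the left of [v]. The angularly first
    such vertex is the successor; the opposite form gives the predecessor. *)
Lemma vertex_polygon (R : realType) (Q : set 'cV[R]_2) : LDP_polygon Q ->
  polygon (vertex_set Q).
Proof.
move=> hQ v Vv; have bv := vertex_bezout hQ Vv; split=> //.
  have l0 := covec_ptv_neq0 R bv; have [z [/= Vz _ lz]] := vertex_max hQ l0.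
  have [s sE] := vertex_finite hQ.
  have /sE zs := Vz.
  have [[w [/sE Vw lw wP]] _] := exists_extreme zs lz.
  rewrite dot_covec_ptv ltr0z in lw; exists w.
  apply: empty_cone_edge => // y Vy vy yw.
  have /sE ys := Vy; have := wP y ys; rewrite dot_covec_ptv ltr0z => /(_ vy).
  by move: yw; rewrite /det2; lia.
have l0 : - covec (- v.2%:~R) v.1%:~R != 0 :> 'rV[R]_2.
  by rewrite oppr_eq0 covec_ptv_neq0.
have dotN z : dot (- covec (- v.2%:~R) v.1%:~R : 'rV[R]_2) (ptv R z) = (det2 z v)%:~R.
  by rewrite -scaleN1r dotZl dot_covec_ptv mulN1r -intrN /det2; congr intr; ring.
have [z [/= Vz _ lz]] := vertex_max hQ l0.
have [s sE] := vertex_finite hQ.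
have /sE zs := Vz.
have [_ [w [/sE Vw lw wP]]] := exists_extreme zs lz.
rewrite dotN ltr0z in lw; exists w.
apply: empty_cone_edge => // y Vy wy yv.
have /sE ys := Vy; have := wP y ys; rewrite dotN ltr0z => /(_ yv).
by move: wy; rewrite /det2; lia.
Qed.

Lemma det_decomp (R : realType) (v w : vec) (x : 'cV[R]_2) :
  (det2 v w)%:~R *: x =
  - dot (covec (- w.2%:~R) w.1%:~R) x *: ptv R v +
  dot (covec (- v.2%:~R) v.1%:~R) x *: ptv R w.
Proof.
by apply: plane_eq; rewrite !mxE !dot_covec /det2 intrD intrN !intrM /=; ring.
Qed.

(** The form [l] sends a point to its determinant with [x]. Counterclockwise, [v] is the last vertex
    where this is positive, so its successor has reached or passed the direction of [x]. *)
Lemma cone_decomp (R : realType) (Q : set 'cV[R]_2) (x : 'cV[R]_2) :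
  LDP_polygon Q -> x != 0 -> exists v w a b,
    [/\ edge (vertex_set Q) v w, 0 <= a, 0 <= b & x = a *: ptv R v + b *: ptv R w].
Proof.
move=> hQ x0; pose l : 'rV[R]_2 := covec (x 1 0) (- x 0 0).
have lE z : dot l (ptv R z) = dot (covec (- z.2%:~R) z.1%:~R) x.
  by rewrite !dot_covec ptv0 ptv1; ring.
have l0 : l != 0.
  apply: contraNneq x0 => /covec_eq0[x1 /eqP]; rewrite oppr_eq0 => /eqP x0.
  by apply/eqP/plane_eq; rewrite ?x0 ?x1 mxE.
have [z [Vz _ lz]] := vertex_max hQ l0.
have [s sE] := vertex_finite hQ.
have /sE zs := Vz.
have [_ [v [/sE Vv lv vP]]] := exists_extreme zs lz.
have [_ [w vw] _] := vertex_polygon hQ Vv.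
have D0 : 0 < (det2 v w)%:~R :> R by rewrite ltr0z; case: vw.
have lw : dot l (ptv R w) <= 0.
  rewrite leNgt; apply/negP => lw.
  have /sE ws := edge_dst vw; have := vP w ws lw.
  by case: vw => _ _ + _; rewrite /det2; lia.
exists v, w, ((det2 v w)%:~R^-1 * - dot l (ptv R w)), ((det2 v w)%:~R^-1 * dot l (ptv R v)).
split=> //; first by rewrite mulr_ge0 ?invr_ge0 ?oppr_ge0// ltW.
  by rewrite mulr_ge0 ?invr_ge0// ltW.
by rewrite -!scalerA -scalerDr !lE -det_decomp scalerA mulVf ?scale1r ?gt_eqF.
Qed.

(** * Supporting lines of edges and the hull of the vertices *)

Definition edge_form (R : realType) (v w : vec) : 'rV[R]_2 :=
  covec (w.2 - v.2)%:~R (v.1 - w.1)%:~R.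

Lemma edge_formE (R : realType) v w z :
  dot (edge_form R v w) (ptv R z) = (det2 v z + det2 z w)%:~R.
Proof. by rewrite dot_covec ptv0 ptv1 -!intrM -intrD; congr intr; rewrite /det2; ring. Qed.

Lemma edge_form_l (R : realType) v w : dot (edge_form R v w) (ptv R v) = (det2 v w)%:~R.
Proof. by rewrite edge_formE; congr intr; rewrite /det2; ring. Qed.

Lemma edge_form_r (R : realType) v w : dot (edge_form R v w) (ptv R w) = (det2 v w)%:~R.
Proof. by rewrite edge_formE; congr intr; rewrite /det2; ring. Qed.

Lemma dot_neq0 (R : realType) (l : 'rV[R]_2) x : dot l x != 0 -> l != 0.
Proof. by apply: contraNneq => ->; rewrite /dot mul0mx mxE. Qed.

Lemma edge_form_neq0 (R : realType) v w : 0 < det2 v w -> edge_form R v w != 0.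
Proof.
by move=> d0; apply: (@dot_neq0 _ _ (ptv R v)); rewrite edge_form_l intr_eq0 gt_eqF.
Qed.

Lemma edge_form_le (R : realType) (Q : set 'cV[R]_2) v w x : LDP_polygon Q ->
  edge (vertex_set Q) v w -> Q x -> dot (edge_form R v w) x <= (det2 v w)%:~R.
Proof.
move=> hQ vw Qx; have [_ _ d0 _] := vw.
have [z [Vz zmax _]] := vertex_max hQ (edge_form_neq0 R d0).
by apply: le_trans (zmax _ Qx) _; rewrite edge_formE ler_int; apply: (edge_le vw).
Qed.

Lemma convex_comb3 (R : realType) (C : set 'cV[R]_2) x y z (a b c : R) :
  convex_comb C -> C x -> C y -> C z -> 0 <= a -> 0 <= b -> 0 <= c -> a + b + c = 1 ->
  C (a *: x + b *: y + c *: z).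
Proof.
move=> cC Cx Cy Cz a0 b0 c0 abc.
have [ab|ab] := eqVneq (a + b) 0.
  have [-> [-> ->]] : a = 0 /\ b = 0 /\ c = 1 by lra.
  by rewrite !scale0r !add0r scale1r.
have ab0 : 0 < a + b by rewrite lt_neqAle eq_sym ab addr_ge0.
have -> : a *: x + b *: y = (a + b) *: (a / (a + b) *: x + b / (a + b) *: y).
  by rewrite scalerDr !scalerA ![(a + b) * _]mulrC !divfK.
apply: (cC) => //; last exact: ltW.
by apply: cC => //; rewrite ?divr_ge0 ?(ltW ab0) // -mulrDl divff.
Qed.

(** A nonzero point of [Q] lies in the cone of an edge, and the edge form bounds the sum of its
    coefficients by 1, so it is a convex combination of the two ends and 0. For 0 itself, the
    opposite of a vertex is decomposed in the cone of an edge and the resulting relation is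
    normalized. *)
Lemma LDP_hull_vertices (R : realType) (Q : set 'cV[R]_2) : LDP_polygon Q ->
  Q = convex_hull (ptv R @` vertex_set Q).
Proof.
move=> hQ; set H := convex_hull _.
have cH : convex_comb H by apply: convex_hull_convex.
have VH z : vertex_set Q z -> H (ptv R z).
  by move=> Vz; apply: sub_convex_hull; exists z.
apply/seteqP; split; last first.
  apply: convex_hull_min; first exact: LDP_convex.
  by move=> _ [z Vz <-]; have [l []] := vertex_exposed hQ Vz.
have H0 : H 0.
  pose l : 'rV[R]_2 := covec 1 0.
  have l0 : l != 0 by apply/eqP => /covec_eq0[/eqP]; rewrite oner_eq0.
  have [z [Vz _ lz]] := vertex_max hQ l0.
  have nz : - ptv R z != 0.
    by rewrite oppr_eq0; apply/eqP/ptv_neq0; apply: vertex_bezout Vz.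
  have [v [w [a [b [vw a0 b0 E]]]]] := cone_decomp hQ nz.
  pose k := 1 + a + b.
  have k0 : 0 < k by rewrite /k; lra.
  have -> : 0 = k^-1 *: ptv R z + (k^-1 * a) *: ptv R v + (k^-1 * b) *: ptv R w.
    by rewrite -!scalerA -addrA -!scalerDr -E subrr scaler0.
  apply: convex_comb3 => //; try exact: VH.
  - by apply: VH; apply: edge_src vw.
  - by apply: VH; apply: edge_dst vw.
  - by rewrite invr_ge0 ltW.
  - by rewrite mulr_ge0 ?invr_ge0// ltW.
  - by rewrite mulr_ge0 ?invr_ge0// ltW.
  - by rewrite -[X in X + _ + _]mulr1 -!mulrDr mulVf ?gt_eqF.
move=> x Qx; have [->//|x0] := eqVneq x 0.
have [v [w [a [b [vw a0 b0 E]]]]] := cone_decomp hQ x0.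
have D0 : 0 < (det2 v w)%:~R :> R by rewrite ltr0z; case: vw.
have := edge_form_le hQ vw Qx; rewrite {1}E dotD !dotZ edge_form_l edge_form_r.
rewrite -mulrDl ger_pMl// => ab.
have -> : x = a *: ptv R v + b *: ptv R w + (1 - (a + b)) *: 0.
  by rewrite scaler0 addr0.
apply: convex_comb3 => //.
- by apply: VH; apply: edge_src vw.
- by apply: VH; apply: edge_dst vw.
- by rewrite subr_ge0.
- by rewrite subrKC.
Qed.

(** * Singular points *)

Lemma pos_span_convex (R : realType) (x y : 'cV[R]_2) : convex_comb (pos_span x y).
Proof.
move=> u v a b [a1 [b1 [a10 b10 ->]]] [a2 [b2 [a20 b20 ->]]] a0 b0 _.
exists (a * a1 + b * a2), (a * b1 + b * b2); split; rewrite ?addr_ge0 ?mulr_ge0 //.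
by rewrite !scalerDr !scalerDl !scalerA addrACA.
Qed.

Lemma pos_span_l (R : realType) (x y : 'cV[R]_2) : pos_span x y x.
Proof. by exists 1, 0; split; rewrite ?ler01 // scale1r scale0r addr0. Qed.

Lemma pos_span_r (R : realType) (x y : 'cV[R]_2) : pos_span x y y.
Proof. by exists 0, 1; split; rewrite ?ler01 // scale1r scale0r add0r. Qed.

(** The line through [v] and [w] supports [Q]. By [hull_face], applied to the convex set [pos_span],
    the face it cuts out stays inside the cone of [v] and [w]. *)
Lemma edge_fan (R : realType) (Q : set 'cV[R]_2) v w : LDP_polygon Q ->
  edge (vertex_set Q) v w -> fan Q (pos_span (ptv R v) (ptv R w)).
Proof.
move=> hQ vw; have [Vv Vw d0 lt] := vw.
pose F := Q `&` [set x | dot (edge_form R v w) x = (det2 v w)%:~R].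
have Qv : Q (ptv R v) by have [l []] := vertex_exposed hQ Vv.
have Qw : Q (ptv R w) by have [l []] := vertex_exposed hQ Vw.
have lv := edge_form_l R v w.
have lw := edge_form_r R v w.
have Fspan : F `<=` pos_span (ptv R v) (ptv R w).
  move=> x [Qx lx]; rewrite (LDP_hull_vertices hQ) in Qx.
  apply: (hull_face (@pos_span_convex R _ _) _ Qx lx) => _ [z Vz <-].
  have [->|zv] := eqVneq z v; first by right; split=> //; apply: pos_span_l.
  have [->|zw] := eqVneq z w; first by right; split=> //; apply: pos_span_r.
  by left; rewrite edge_formE ltr_int; apply: lt.
have E : cone_over F = pos_span (ptv R v) (ptv R w).
  apply/seteqP; split=> [_ [k [x [k0 /Fspan[a [b [a0 b0 ->]]] ->]]]|].
    by exists (k * a), (k * b); rewrite !mulr_ge0 // scalerDr !scalerA.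
  move=> _ [a [b [a0 b0 ->]]].
  have [ab|ab] := eqVneq (a + b) 0.
    have [-> ->] : a = 0 /\ b = 0 by lra.
    by exists 0, (ptv R v); rewrite !scale0r addr0.
  have ab0 : 0 < a + b by rewrite lt_neqAle eq_sym ab addr_ge0.
  have s1 : a / (a + b) + b / (a + b) = 1 by rewrite -mulrDl divff.
  exists (a + b), (a / (a + b) *: ptv R v + b / (a + b) *: ptv R w); split.
  - exact: ltW.
  - split; first by apply: (LDP_convex hQ); rewrite // divr_ge0 // ltW.
    by rewrite /= dotD !dotZ lv lw -mulrDl s1 mul1r.
  - by rewrite scalerDr !scalerA ![(a + b) * _]mulrC !divfK.
exists F; last first.
  exists 0; rewrite E; split=> [x _|]; first by rewrite /dot mul0mx mxE.
  by apply/seteqP; split=> [x sx|x []//]; split=> //=; rewrite /dot mul0mx mxE.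
split; last first.
  exists (ptv R v), (ptv R w); split=> // /ptv_inj vwE.
  by move: d0; rewrite vwE /det2; lia.
exists (edge_form R v w), (det2 v w)%:~R; split=> //; first exact: edge_form_neq0.
by move=> x; apply: edge_form_le.
Qed.

(** A vertex in the cone over [F] is k x with x in [F]. Here [k <= 1] by the form of [F], while a
    form exposing the vertex forces [k > 1] unless x is the vertex; so [v] and [w] lie on [F]. A
    vertex in the open cone between them would be a combination of coefficient sum at most 1, which
    no form could expose. *)
Lemma fan_edge (R : realType) (Q : set 'cV[R]_2) v w : LDP_polygon Q ->
  vertex_set Q v -> vertex_set Q w -> 0 < det2 v w ->
  fan Q (pos_span (ptv R v) (ptv R w)) -> edge (vertex_set Q) v w.
Proof.
move=> hQ Vv Vw d0 [F [[l [c [l0 Qc FE]]] _] [m [_ E]]].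
have c0 : 0 < c.
  have [z [Vz _ lz]] := vertex_max hQ l0.
  by have [l' [_ /Qc Qz _]] := vertex_exposed hQ Vz; lra.
have face z : vertex_set Q z -> pos_span (ptv R v) (ptv R w) (ptv R z) ->
    dot l (ptv R z) = c.
  move=> Vz; rewrite E => -[[k [x [k0 Fx zE]]] _].
  have [Qx lx] : (Q `&` [set x | dot l x = c]) x by rewrite -FE.
  have [l' [l'0 Qz lt]] := vertex_exposed hQ Vz.
  have k1 : k <= 1.
    by have := Qc _ Qz; rewrite zE dotZ lx ger_pMl.
  have [xz|xz] := pselect (x = ptv R z); first by rewrite -xz.
  have := lt x Qx xz; rewrite {1}zE dotZ => lt'.
  have : 0 < dot l' x by move: l'0; rewrite zE dotZ => h; nra.
  by move: l'0; rewrite zE dotZ; nra.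
have lv := face v Vv (@pos_span_l R _ _).
have lw := face w Vw (@pos_span_r R _ _).
apply: empty_cone_edge => // z Vz vz zw.
have D0 : 0 < (det2 v w)%:~R :> R by rewrite ltr0z.
have y0 : 0 < (det2 v z)%:~R :> R by rewrite ltr0z.
have x0 : 0 < (det2 z w)%:~R :> R by rewrite ltr0z.
have [l' [l'0 lt]] := vertex_exposed_vertex hQ Vz.
have zv : v != z by apply/eqP => e; move: vz; rewrite e /det2; lia.
have zw' : w != z by apply/eqP => e; move: zw; rewrite e /det2; lia.
have [l'' [_ /Qc Qz _]] := vertex_exposed hQ Vz.
have := dot_ptv_plucker l v w z; have := dot_ptv_plucker l' v w z.
rewrite lv lw; have := lt v Vv zv; have := lt w Vw zw'.
move: x0 y0 D0 Qz l'0.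
move: (dot l' (ptv R z)) (dot l' (ptv R v)) (dot l' (ptv R w)) (dot l (ptv R z)).
move=> a b e f; move: ((det2 z w)%:~R) ((det2 v z)%:~R) ((det2 v w)%:~R).
move=> X Y D X0 Y0 D0 fc a0 wa va E1 E2.
have : X + Y <= D.
  have : (X + Y) * c <= D * c by rewrite mulrDl -E2 ler_pM2l.
  by rewrite ler_pM2r.
nra.
Qed.

Lemma det_mx2 (K : comNzRingType) (M : 'M[K]_2) :
  \det M = M 0 0 * M 1 1 - M 0 1 * M 1 0.
Proof.
rewrite (expand_det_row _ 0) big_ord_recl big_ord1 /cofactor !det_mx11 !mxE /=.
rewrite expr0 mul1r expr1 mulN1r mulrN.
by congr (_ * M _ _ - M _ _ * M _ _); apply: val_inj.
Qed.

Lemma det_row_mx (v w : 'cV[int]_2) :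
  \det (row_mx v w) = det2 (v 0 0, v 1 0) (w 0 0, w 1 0).
Proof.
have E0 i : row_mx v w i 0 = v i 0.
  by rewrite -(row_mxEl v w i 0); congr (row_mx v w i _); apply: val_inj.
have E1 i : row_mx v w i 1 = w i 0.
  by rewrite -(row_mxEr v w i 0); congr (row_mx v w i _); apply: val_inj.
by rewrite det_mx2 !E0 !E1 /det2 /= [v 1 0 * _]mulrC.
Qed.

Lemma singular_pointsE (R : realType) (Q : set 'cV[R]_2) s : LDP_polygon Q ->
  singular_points Q s <-> exists v w, singular_edge (vertex_set Q) v w /\
    s = pos_span (ptv R v) (ptv R w).
Proof.
move=> hQ; split=> [[fs [v [w [Qv Qw d sE]]]]|[v [w [[vw d] ->]]]].
  exists (v 0 0, v 1 0), (w 0 0, w 1 0); rewrite -!real_vec_ptv; split=> //.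
  rewrite det_row_mx in d; split=> //; rewrite !real_vec_ptv in Qv Qw sE.
  by apply: fan_edge => //; [lia|rewrite -sE].
split; first exact: edge_fan.
have [Vv Vw _ _] := vw.
exists (latvec v.1 v.2), (latvec w.1 w.2); split=> //.
by rewrite det_row_mx !mxE /= -!surjective_pairing.
Qed.

Lemma pos_span_vertex (R : realType) (Q : set 'cV[R]_2) v w z : LDP_polygon Q ->
  edge (vertex_set Q) v w -> vertex_set Q z ->
  pos_span (ptv R v) (ptv R w) (ptv R z) -> z = v \/ z = w.
Proof.
move=> hQ vw Vz [a [b [a0 b0 E]]].
have D0 : 0 <= (det2 v w)%:~R :> R by rewrite ler0z; case: vw => _ _ /ltW.
have dvv x : det2 x x = 0 by rewrite /det2; ring.
apply: (edge_cone (vertex_polygon hQ) vw Vz); rewrite -(ler0z R).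
  by rewrite -dot_covec_ptv E dotD !dotZ !dot_covec_ptv dvv mulr0 add0r mulr_ge0.
have -> : det2 z w = - det2 w z by rewrite /det2; ring.
rewrite intrN -dot_covec_ptv E dotD !dotZ !dot_covec_ptv dvv mulr0 addr0.
have -> : det2 w v = - det2 v w by rewrite /det2; ring.
by rewrite intrN mulrN opprK mulr_ge0.
Qed.

(** Singular points are counted as cones, hence as sets, so distinct edges must span distinct cones.
    Matching the ends crosswise is excluded by the sign of the determinant. *)
Lemma pos_span_inj (R : realType) (Q : set 'cV[R]_2) v w v' w' : LDP_polygon Q ->
  edge (vertex_set Q) v w -> edge (vertex_set Q) v' w' ->
  pos_span (ptv R v) (ptv R w) = pos_span (ptv R v') (ptv R w') -> (v, w) = (v', w').
Proof.
move=> hQ vw vw' E; have [Vv Vw d0 _] := vw; have [_ _ d0' _] := vw'.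
have := pos_span_vertex hQ vw' Vv; rewrite -E => /(_ (@pos_span_l R _ _)).
have := pos_span_vertex hQ vw' Vw; rewrite -E => /(_ (@pos_span_r R _ _)).
have dvv x : det2 x x = 0 by rewrite /det2; ring.
move=> [] Ew [] Ev; subst v w => //; rewrite ?dvv // in d0.
by move: d0 d0'; rewrite /det2; lia.
Qed.

Lemma card_eq_II2 (T : Type) (S : set T) :
  (S #= `I_2)%card <-> exists s t, s <> t /\ S = [set s; t].
Proof.
split=> [/card_set_bijP[f [fS finj fsurj]]|[s [t [st ->]]]].
  have [s Ss fs] := fsurj 0%N isT; have [t St ft] := fsurj 1%N isT.
  exists s, t; split=> [E|]; first by rewrite E ft in fs.
  apply/seteqP; split=> [x Sx|x [] -> //].
  have := fS x Sx; rewrite /=; case fx : (f x) => [|[|//]] _.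
    by left; apply: finj; rewrite ?inE // fx.
  by right; apply: finj; rewrite ?inE // fx.
pose f x := if pselect (x = s) then 0%N else 1%N.
have fs : f s = 0%N by rewrite /f; case: (pselect (s = s)).
have ft : f t = 1%N by rewrite /f; case: (pselect (t = s)) => // ts; case: st.
apply/card_set_bijP; exists f; split.
- by move=> x [] ->; rewrite ?fs ?ft.
- by move=> x y; rewrite !inE => -[]-> []->; rewrite ?fs ?ft.
- by move=> [|[|//]] _; [exists s; first by left|exists t; first by right].
Qed.

Lemma singular_points_two (R : realType) (Q : set 'cV[R]_2) : LDP_polygon Q ->
  (singular_points Q #= `I_2)%card <-> two_singular (vertex_set Q).
Proof.
move=> hQ; rewrite card_eq_II2; split=> [[s [t [st E]]]|].
  have [] : singular_points Q s /\ singular_points Q t by rewrite E; split; [left|right].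
  move=> /(singular_pointsE _ hQ)[u1 [v1 [h1 sE]]].
  move=> /(singular_pointsE _ hQ)[u2 [v2 [h2 tE]]].
  exists u1, v1, u2, v2; split=> //.
    by apply/eqP => -[e1 e2]; apply: st; rewrite sE tE e1 e2.
  move=> u v uv; have : singular_points Q (pos_span (ptv R u) (ptv R v)).
    by apply/(singular_pointsE _ hQ); exists u, v.
  rewrite E sE tE => -[] e.
    by left; apply: (pos_span_inj hQ uv.1 h1.1 e).
  by right; apply: (pos_span_inj hQ uv.1 h2.1 e).
move=> [u1 [v1 [u2 [v2 [h1 h2 n12 all12]]]]].
exists (pos_span (ptv R u1) (ptv R v1)), (pos_span (ptv R u2) (ptv R v2)); split.
  by move=> /(pos_span_inj hQ h1.1 h2.1) /eqP; rewrite (negbTE n12).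
apply/seteqP; split=> [s /(singular_pointsE _ hQ)[u [v [/all12 uv ->]]]|s].
  by case: uv => -[-> ->]; [left|right].
by move=> [] ->; apply/(singular_pointsE _ hQ); [exists u1, v1|exists u2, v2].
Qed.

(** * Equivalence of polygons *)

Lemma convex_hull_mulmx (R : realType) (M : 'M[R]_2) (A : set 'cV[R]_2) :
  [set M *m x | x in convex_hull A] = convex_hull [set M *m x | x in A].
Proof.
apply/seteqP; split.
  move=> _ [x hx <-].
  suff : convex_hull A `<=` [set y | convex_hull [set M *m x | x in A] (M *m y)].
    by apply.
  apply: convex_hull_min => [y z a b /= hy hz a0 b0 ab|y Ay /=].
    by rewrite mulmxDr -!scalemxAr; apply: convex_hull_convex.
  by apply: sub_convex_hull; exists y.
apply: convex_hull_min => [y z a b [u hu <-] [v hv <-] a0 b0 ab|_ [x Ax <-]].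
  exists (a *: u + b *: v); first exact: convex_hull_convex.
  by rewrite mulmxDr -!scalemxAr.
by exists x => //; apply: sub_convex_hull.
Qed.

Lemma vertices_mulmx (R : realType) (M : 'M[R]_2) (Q : set 'cV[R]_2) x :
  M \in unitmx -> vertices Q x -> vertices [set M *m y | y in Q] (M *m x).
Proof.
move=> Mu /vertices_exposed[l [l0 Qx lt]].
have E y : dot (l *m invmx M) (M *m y) = dot l y by rewrite /dot mulmxA mulmxKV.
apply: (@exposed_vertices _ _ _ (l *m invmx M)).
- by apply: contraNneq l0 => E0; rewrite -[l](mulmxKV Mu) E0 mul0mx.
- by exists x.
- by move=> _ [y Qy <-] yx; rewrite !E; apply: lt => // e; apply: yx; rewrite e.
Qed.

Lemma intr_mulmx_ptv (R : realType) (U : 'M[int]_2) z :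
  map_mx intr U *m ptv R z = ptv R (act (U 0 0) (U 0 1) (U 1 0) (U 1 1) z).
Proof.
have e1 : lift 0 0 = 1 :> 'I_2 by apply: val_inj.
by apply: plane_eq; rewrite ?ptv0 ?ptv1 mxE big_ord_recl big_ord1 !mxE /= e1 intrD !intrM.
Qed.

(** Each of the two edge forms, scaled to 1 on its edge, is less than 1 at all other points of [L].
    Their sum reaches 2 only at the common end [p]. *)
Lemma hull_vertex (R : realType) (L : seq vec) u p w :
  edge (fun z => z \in L) u p -> edge (fun z => z \in L) p w ->
  vertices (convex_hull (ptv R @` [set` L])) (ptv R p).
Proof.
move=> [Lu Lp up0 up] [_ Lw pw0 pw].
have D1 : 0 < (det2 u p)%:~R :> R by rewrite ltr0z.
have D2 : 0 < (det2 p w)%:~R :> R by rewrite ltr0z.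
pose l := (det2 u p)%:~R^-1 *: edge_form R u p + (det2 p w)%:~R^-1 *: edge_form R p w.
have lp : dot l (ptv R p) = 2.
  by rewrite dotDl !dotZl edge_form_l edge_form_r !mulVf ?gt_eqF.
apply: (@exposed_vertices _ _ _ l).
- by apply: (@dot_neq0 _ _ (ptv R p)); rewrite lp pnatr_eq0.
- by apply: sub_convex_hull; exists p.
apply: dot_hull_lt => _ [z /= Lz <-] zp; rewrite lp dotDl !dotZl !edge_formE.
have {}zp : z != p by apply: contra_notN zp => /eqP ->.
rewrite ![_^-1 * _]mulrC.
have [zu|zu] := eqVneq z u.
  have zw : z != w by apply/eqP => zw; move: up0 pw0; rewrite -zu zw /det2; lia.
  have h1 : det2 u z + det2 z p = det2 u p by rewrite zu /det2; ring.
  rewrite h1 mulfV ?gt_eqF// (_ : 2 = 1 + 1 :> R) // ltrD2l.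
  by rewrite ltr_pdivrMr// mul1r ltr_int; apply: pw.
have h1 : (det2 u z + det2 z p)%:~R / (det2 u p)%:~R < 1 :> R.
  by rewrite ltr_pdivrMr// mul1r ltr_int; apply: up.
have h2 : (det2 p z + det2 z w)%:~R / (det2 p w)%:~R <= 1 :> R.
  rewrite ler_pdivrMr// mul1r ler_int; have [->|zw] := eqVneq z w.
    by rewrite /det2; lia.
  by apply/ltW/pw.
by rewrite (_ : 2 = 1 + 1 :> R) // ltr_leD.
Qed.

(** The hypothesis on [L] puts its points in strictly convex position, so they are exactly the
    vertices of their hull, and a unimodular map carries vertices to vertices. The converse holds
    because [Q] is the hull of its vertices and hulls commute with linear maps. *)
Lemma equivalent_hull (R : realType) (Q : set 'cV[R]_2) (L : seq vec) :
  LDP_polygon Q ->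
  (forall v, v \in L -> (exists w, edge (fun z => z \in L) v w) /\
                        (exists u, edge (fun z => z \in L) u v)) ->
  equivalent Q (convex_hull (ptv R @` [set` L])) <->
  equivZ (vertex_set Q) (fun z => z \in L).
Proof.
move=> hQ cvxL; split=> [[U [dU E]]|[a [b [c [d [e VL]]]]]].
  exists (U 0 0), (U 0 1), (U 1 0), (U 1 1); rewrite -det_mx2; split=> // z.
  have Uu : (map_mx intr U : 'M[R]_2) \in unitmx.
    by rewrite unitmxE det_map_mx; case: dU => ->; rewrite ?rmorphN1 ?unitrN ?unitr1.
  split=> [Vz|Lz].
    have := vertices_mulmx Uu Vz; rewrite E => /vertices_hull_sub[y /= Ly].
    by rewrite intr_mulmx_ptv => /ptv_inj <-.
  have [[w zw] [u uz]] := cvxL _ Lz.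
  have := hull_vertex R uz zw; rewrite -E -intr_mulmx_ptv.
  have Uiu : invmx (map_mx intr U : 'M[R]_2) \in unitmx by rewrite unitmx_inv.
  move=> /(vertices_mulmx Uiu); rewrite mulKmx //.
  have -> : [set invmx (map_mx intr U) *m y | y in [set map_mx intr U *m x | x in Q]] = Q.
    apply/seteqP; split=> [_ [_ [x Qx <-] <-]|x Qx]; first by rewrite mulKmx.
    by exists (map_mx intr U *m x); [exists x|rewrite mulKmx].
  by [].
pose U : 'M[int]_2 := \matrix_(i, j) if i == 0 then (if j == 0 then a else b)
                                      else (if j == 0 then c else d).
have U00 : U 0 0 = a by rewrite mxE.
have U01 : U 0 1 = b by rewrite mxE.
have U10 : U 1 0 = c by rewrite mxE.
have U11 : U 1 1 = d by rewrite mxE.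
exists U; rewrite det_mx2 U00 U01 U10 U11; split=> //.
rewrite {1}(LDP_hull_vertices hQ) convex_hull_mulmx; congr convex_hull.
have [f ff fE] : exists2 f, f * f = 1 & a * d - b * c = f.
  by case: e => ->; [exists 1 | exists (-1)].
apply/seteqP; split=> [_ [_ [z Vz <-] <-]|_ [z /= Lz <-]].
  by rewrite intr_mulmx_ptv U00 U01 U10 U11; eexists; last by []; apply/VL.
have zE := act_inv z fE ff.
exists (ptv R (act (f * d) (- (f * b)) (- (f * c)) (f * a) z)).
  by eexists; last by []; apply/VL; rewrite zE.
by rewrite intr_mulmx_ptv U00 U01 U10 U11 zE.
Qed.

Lemma picard_number_le (R : realType) (Q : set 'cV[R]_2) (L : seq vec) :
  (size L <= 5)%N -> equivZ (vertex_set Q) (fun z => z \in L) ->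
  LDP_polygon Q -> picard_number Q <= 3.
Proof.
move=> L5 [a [b [c [d [e VL]]]]] hQ.
have [f ff fE] : exists2 f, f * f = 1 & a * d - b * c = f.
  by case: e => ->; [exists 1 | exists (-1)].
pose g := act (f * d) (- (f * b)) (- (f * c)) (f * a).
have : (size (fset_set (vertices Q)) <= size [seq ptv R (g z) | z <- L])%N.
  apply: uniq_leq_size => [|x]; first exact: fset_uniq.
  rewrite in_fset_set ?inE; last exact: finite_vertices.
  move=> Qx; have [z Vz ->] := vertices_ptv hQ Qx.
  by apply/mapP; exists (act a b c d z); [apply/VL|rewrite /g act_invr].
by rewrite size_map /picard_number; lia.
Qed.

Lemma set_cons (T : eqType) (x : T) (s : seq T) : [set` x :: s] = x |` [set` s].
Proof. by apply/seteqP; split=> y /=; rewrite inE => /predU1P. Qed.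

Lemma set_nil (T : eqType) : [set` [::] : seq T] = set0.
Proof. by apply/seteqP; split. Qed.

Lemma equivalent_chain (R : realType) (Q : set 'cV[R]_2) u s : LDP_polygon Q ->
  chain (fun z => z \in u :: s) u s u ->
  equivalent Q (convex_hull (ptv R @` [set` u :: s])) <->
  equivZ (vertex_set Q) (fun z => z \in u :: s).
Proof. by move=> hQ us; apply: equivalent_hull => // v; apply: chain_succ_pred us v. Qed.

Lemma type1E (R : realType) (Q : set 'cV[R]_2) : LDP_polygon Q ->
  is_type1 (vertex_set Q) <-> exists p q : int, [/\ 2 <= p, 2 <= q, gcdz p q = 1
    & equivalent Q (convex_hull [set pt R 1 0; pt R 0 1; pt R (- p) (- q)])].
Proof.
move=> hQ; split=> -[p [q [p2 q2 g E]]]; exists p, q; split=> //.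
all: have [p0 q0] : 0 < p /\ 0 < q by lia.
all: have := equivalent_chain hQ (triangle_chain p0 q0).
all: rewrite !set_cons set_nil !image_setU image_set0 !image_set1 setU0 !setUA.
all: by tauto.
Qed.

Lemma type2E (R : realType) (Q : set 'cV[R]_2) : LDP_polygon Q ->
  is_type2 (vertex_set Q) <-> exists p q r : int, [/\ p <= 1,
    r <= Num.min (Num.min (- (p * q) - 2) (- 2)) (Num.min (- q - 1) (q - p * q - 1)),
    gcdz q r = 1
    & equivalent Q (convex_hull [set pt R 1 0; pt R 0 1; pt R (-1) p; pt R q r])].
Proof.
move=> hQ; split=> -[p [q [r [p1 rmin g E]]]]; exists p, q, r; split=> //.
all: have := equivalent_chain hQ (quadrilateral_chain p1 rmin g).
all: rewrite !set_cons set_nil !image_setU image_set0 !image_set1 setU0 !setUA.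
all: by tauto.
Qed.

Lemma type3E (R : realType) (Q : set 'cV[R]_2) : LDP_polygon Q ->
  is_type3 (vertex_set Q) <-> exists p q r : int, [/\ p <= 0, 1 <= q <= - r - 1,
    gcdz q r = 1
    & equivalent Q (convex_hull [set pt R 1 0; pt R 0 1; pt R (-1) (p + 1);
                                 pt R (-1) p; pt R q r])].
Proof.
move=> hQ; split=> -[p [q [r [p0 qr g E]]]]; exists p, q, r; split=> //.
all: have := equivalent_chain hQ (pentagon_chain p0 qr).
all: rewrite !set_cons set_nil !image_setU image_set0 !image_set1 setU0 !setUA.
all: by tauto.
Qed.

Theorem theorem2 (R : realType) (Q : set 'cV[R]_2) (hQ : LDP_polygon Q) :
  ((singular_points Q #= `I_2)%card <->
     [\/ exists p q : int,
           [/\ 2 <= p, 2 <= q, gcdz p q = 1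
             & equivalent Q (convex_hull [set pt R 1 0; pt R 0 1; pt R (- p) (- q)])],
         exists p q r : int,
           [/\ p <= 1,
               r <= Num.min (Num.min (- (p * q) - 2) (- 2))
                            (Num.min (- q - 1) (q - p * q - 1)),
               gcdz q r = 1
             & equivalent Q
                 (convex_hull [set pt R 1 0; pt R 0 1; pt R (-1) p; pt R q r])]
       | exists p q r : int,
           [/\ p <= 0, 1 <= q <= - r - 1, gcdz q r = 1
             & equivalent Q
                 (convex_hull [set pt R 1 0; pt R 0 1; pt R (-1) (p + 1);
                            pt R (-1) p; pt R q r])]]) /\
  ((singular_points Q #= `I_2)%card -> picard_number Q <= 3).
Proof.
rewrite singular_points_two //; have PV := vertex_polygon hQ.
split; last first.
  move=> /(two_singular_type PV)[[p [q [_ _ _ VL]]]||].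
  - exact: picard_number_le VL hQ.
  - by move=> [p [q [r [_ _ _ VL]]]]; apply: picard_number_le VL hQ.
  - by move=> [p [q [r [_ _ _ VL]]]]; apply: picard_number_le VL hQ.
split=> [/(two_singular_type PV)[]|[]].
- by move=> /type1E; constructor 1; auto.
- by move=> /type2E; constructor 2; auto.
- by move=> /type3E; constructor 3; auto.
- by move=> /(type1E hQ)/type1_singular.
- by move=> /(type2E hQ)/type2_singular.
- by move=> /(type3E hQ)/type3_singular.
Qed.
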